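(* Let $G=G(M^* )$ be a $\emptyset$-definable group in a monster model $M^*\succ M$, equipped with a $\bigvee$-definable group topology $\mathcal T$ such that for all $n\in\mathbb N$ the projections (to all subproducts) of every type-definable, closed set in $G^n$ are closed. Assume that $\mathcal D_{\mathcal T}$ carries a normalized, $G$-invariant mean $m$. Then $\mathrm{cl}(G^{00}_M)=\mathrm{cl}(G^{000}_M)$. More precisely, there exists an $M$-type-definable set $\widehat D\subseteq G^{000}_M$ with $\mathrm{cl}(\widehat D)=\mathrm{cl}(G^{00}_M)$. In fact, for any closed, $M$-type-definable set $P$ which is wide (i.e. $m(P)>0$) we have $P^4:=PPP^{-1}P^{-1}\supseteq G^{00}_M$.
   Context: A monster model is a $\kappa$-saturated, strongly $\kappa$-homogeneous model for a sufficiently large cardinal $\kappa$; bounded/small means of cardinality $<\kappa$; $M$ is small. Type-definable sets are over small sets of parameters. $G^{00}_M$ is the smallest $M$-type-definable subgroup of $G$ of bounded index; $G^{000}_M$ is the smallest $\mathrm{Aut}(M^*/M)$-invariant subgroup of $G$ of bounded index. A $\bigvee$-definable family of definable subsets of $G$ is a class $\mathcal T=\{\varphi_i(x,\bar y_i): i\in I,\ \bar y_i \text{ from any model}\}$, where the $\varphi_i$ are formulas over $\emptyset$ implying $G(x)$; here $I$ is a directed set such that for $i<j$, for every $\bar y_i$ there is $\bar y_j$ such that $\varphi_j(x,\bar y_j)$ implies $\varphi_i(x,\bar y_i)$. For a model $N$, $\mathcal T(N):=\{\varphi_i(N,\bar y_i): i\in I,\ \bar y_i\in N\}$. A $\bigvee$-definable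 group topology on $G$ is such a family $\mathcal T$, consisting of sets containing $1$, such that in any model $N$, $\mathcal T(N)$ forms a basis of (not necessarily open) neighborhoods of the identity for a (not necessarily Hausdorff) topology on $G(N)$ making the group operations continuous. The topology on $G=G(M^* )$ is the one induced by $\mathcal T(M^* )$, $G^n$ has the product topology, and $\mathrm{cl}$ denotes the closure in the topology on $G$. $\mathcal D_{\mathcal T}$ is the lattice of closed subsets of $G$ that are type-definable in $M^*$ over arbitrary (small sets of) parameters; it is closed under left translations by $G$. A normalized $G$-invariant mean on it is a monotone function $m:\mathcal D_{\mathcal T}\to[0,1]$ with $m(\emptyset)=0$, $m(G)=1$, $m(Y\cup Z)=m(Y)+m(Z)-m(Y\cap Z)$, and $m(gY)=m(Y)$ for $g\in G$. *)

(* Defs.v *)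
From HB Require Import structures.
From mathcomp Require Import all_boot all_order all_algebra.
From mathcomp Require Import all_classical all_reals topology function_spaces.

Set Implicit Arguments.
Unset Strict Implicit.
Unset Printing Implicit Defensive.

Local Open Scope classical_set_scope.

(** * First-order logic (one-sorted, with equality) *)

Record language := Language {
  fsym : Type;
  far : fsym -> nat;
  rsym : Type;
  rar : rsym -> nat
}.

Record structure (L : language) := Structure {
  carrier :> Type;
  fint : forall f : fsym L, ('I_(far f) -> carrier) -> carrier;
  rint : forall r : rsym L, ('I_(rar r) -> carrier) -> Prop
}.

Inductive term (L : language) (V : Type) : Type :=
| Tvar (v : V)
| Tapp (f : fsym L) (t : 'I_(far f) -> term L V).

(* [form L V] : L-formulas whose free variables are among V; a quantifier binds
   the variable [None] of [option V]. *)
Inductive form (L : language) (V : Type) : Type :=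
| Fbot
| Feq (t u : term L V)
| Frel (r : rsym L) (t : 'I_(rar r) -> term L V)
| Fimp (phi psi : form L V)
| Fall (phi : form L (option V)).

Section Satisfaction.
Context (L : language) (N : structure L).

Fixpoint teval (V : Type) (v : V -> N) (t : term L V) : N :=
  match t with
  | Tvar x => v x
  | Tapp _ u => fint (fun i => teval v (u i))
  end.

Fixpoint sat (V : Type) (phi : form L V) : (V -> N) -> Prop :=
  match phi with
  | Fbot => fun=> False
  | Feq t u => fun v => teval v t = teval v u
  | Frel _ t => fun v => rint (fun i => teval v (t i))
  | Fimp phi psi => fun v => sat phi v -> sat psi v
  | Fall phi => fun v => forall a : N, sat phi (oapp v a)
  end.

End Satisfaction.

Definition assign (V W N : Type) (x : V -> N) (y : W -> N) : V + W -> N :=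
  fun s => match s with inl v => x v | inr w => y w end.

Definition param (N : Type) (A : set N) (a : A) : N := val a.

Section ModelTheory.
Context (L : language).

Definition elementarily_equivalent (N N' : structure L) :=
  forall phi : form L void,
    sat phi (of_void N) <-> sat phi (of_void N').

Definition elementary_embedding (N N' : structure L) (j : N -> N') :=
  forall n (phi : form L 'I_n) (v : 'I_n -> N), sat phi v <-> sat phi (j \o v).

Definition automorphism (N : structure L) (s : N -> N) :=
  [/\ bijective s,
      forall (f : fsym L) (x : 'I_(far f) -> N), s (fint x) = fint (s \o x) &
      forall (r : rsym L) (x : 'I_(rar r) -> N), rint x <-> rint (s \o x)].

(* A formula over V with parameters in A is a formula with free variables in
   V + A, each a : A being assigned to itself. *)
Definition type_definable_over (N : structure L) (A : set N) (V : Type)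
    (X : set (V -> N)) :=
  exists S : set (form L (V + A)),
    X = [set x | forall phi, S phi -> sat phi (assign x (@param _ A))].

End ModelTheory.

(** * Monster models *)

(* A cardinal kappa is represented by a type K of that cardinality. *)
Definition small (K T : Type) (A : set T) :=
  (A #<= [set: K])%card /\ ~ ([set: K] #<= A)%card.

Section Monster.
Context (K : Type) (L : language).

Definition saturated (N : structure L) :=
  forall (A : set N) (n : nat) (S : set (form L ('I_n + A))), small K A ->
    (forall F : set (form L ('I_n + A)), finite_set F -> F `<=` S ->
       exists x : 'I_n -> N, forall phi, F phi -> sat phi (assign x (@param _ A))) ->
    exists x : 'I_n -> N, forall phi, S phi -> sat phi (assign x (@param _ A)).

(* A formula in [form L A] has its free variables indexed by the elements of A,
   so the hypothesis on f says that f is a partial elementary map. *)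
Definition strongly_homogeneous (N : structure L) :=
  forall (A : set N) (f : A -> N), small K A ->
    (forall phi : form L A, sat phi (@param _ A) <-> sat phi f) ->
    exists2 s : N -> N, automorphism s & forall a : A, s (val a) = f a.

Definition monster (N : structure L) := saturated N /\ strongly_homogeneous N.

(* kappa > 2 ^ (|L| + |M| + aleph_0), the right-hand side being the number of
   sets of L-formulas with parameters in M. *)
Definition sufficiently_large (M : structure L) :=
  small K [set: set (form L (nat + M))].

End Monster.

(** * Topological groups *)

HB.mixin Record Group_isTopological G & Topological G & Group G := {
  mulg_continuous : continuous (fun x : G * G => (x.1 * x.2)%g);
  invg_continuous : continuous (fun x : G => (x^-1)%g)
}.

#[short(type="topGroupType")]
HB.structure Definition TopGroup :=
  {G of Topological G & Group G & Group_isTopological G}.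

Section Groups.
Context (G : groupType).

Definition translate (g : G) (A : set G) : set G := [set (g * a)%g | a in A].
Definition mul_set (A B : set G) : set G := [set (a * b)%g | a in A & b in B].
Definition inv_set (A : set G) : set G := [set (a^-1)%g | a in A].

Definition subgroup (H : set G) :=
  [/\ H 1%g, forall x y, H x -> H y -> H (x * y)%g & forall x, H x -> H (x^-1)%g].

Definition bounded_index (K : Type) (H : set G) :=
  small K (range (fun g => translate g H)).

End Groups.

(** * Definable groups and their topologies *)

(* Formulas without parameters defining, respectively, a set of d-tuples and
   the graph of a binary operation on it. *)
Record group_formulas (L : language) (d : nat) := GroupFormulas {
  gdom : form L 'I_d;
  gmul : form L ('I_d + 'I_d + 'I_d)
}.

(* [co] identifies the abstract group G with the group defined in N by Gm: it
   sends an element of G to its coordinates. *)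
Record interprets (L : language) (d : nat) (Gm : group_formulas L d)
    (N : structure L) (G : groupType) (co : G -> 'I_d -> N) : Prop := Interprets {
  co_inj : injective co;
  co_range : range co = [set x | sat (gdom Gm) x];
  co_mul : forall x y z : G,
    (x * y)%g = z <-> sat (gmul Gm) (assign (assign (co x) (co y)) (co z))
}.

Record formula_family (L : language) (d : nat) := FormulaFamily {
  vdisp : Order.disp_t;
  vidx : Order.Preorder.type vdisp;
  varity : vidx -> nat;
  vform : forall i : vidx, form L ('I_d + 'I_(varity i))
}.

Section VTopology.
Context (L : language) (d : nat) (Gm : group_formulas L d)
  (T : formula_family L d).

Record vdefinable_family (N : structure L) : Prop := VdefinableFamily {
  vdirected : forall i j : vidx T, exists k, (i <= k)%O /\ (j <= k)%O;
  vsub : forall (i : vidx T) y (x : 'I_d -> N),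
    sat (vform i) (assign x y) -> sat (gdom Gm) x;
  vmono : forall i j : vidx T, (i < j)%O ->
    forall yi : 'I_(varity i) -> N, exists yj : 'I_(varity j) -> N,
      forall x, sat (vform j) (assign x yj) -> sat (vform i) (assign x yi)
}.

Definition vsets (N : structure L) (G : groupType) (co : G -> 'I_d -> N) :
    set (set G) :=
  [set U | exists (i : vidx T) (y : 'I_(varity i) -> N),
             U = [set g | sat (vform i) (assign (co g) y)]].

(* G is G(N) with the group topology having T(N) as a basis of neighborhoods of
   the identity; by continuity of translations this determines the topology. *)
Record induced_topology (N : structure L) (G : topGroupType)
    (co : G -> 'I_d -> N) : Prop := InducedTopology {
  induced_interprets : interprets Gm co;
  induced_one : forall U, vsets co U -> U 1%g;
  induced_nbhs : forall U, vsets co U -> nbhs (1%g : G) U;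
  induced_basis : forall V, nbhs (1%g : G) V ->
    exists2 U, vsets co U & U `<=` V
}.

Definition vdefinable_group_topology (N0 : structure L) :=
  forall N : structure L, elementarily_equivalent N0 N ->
    vdefinable_family N /\
    exists (G : topGroupType) (co : G -> 'I_d -> N), induced_topology co.

End VTopology.

(** * Type-definable subsets of a definable group *)

Section TypeDefinable.
Context (K : Type) (L : language) (Ms : structure L) (d : nat)
  (G : topGroupType) (co : G -> 'I_d -> Ms).

Definition tdef_over (A : set Ms) (X : set G) :=
  type_definable_over A (co @` X).

Definition tdef (X : set G) := exists2 A : set Ms, small K A & tdef_over A X.

(* The power G^I, as a topological space, and the coordinates of its elements *)
Definition power (I : Type) := prod_topology (fun _ : I => (G : topologicalType)).

Definition power_co (I : Type) (x : power I) : I * 'I_d -> Ms :=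
  fun p => co (x p.1) p.2.

Definition tdef_power (I : Type) (X : set (power I)) :=
  exists2 A : set Ms, small K A & type_definable_over A (@power_co I @` X).

Definition project (n : nat) (J : {set 'I_n}) (x : power 'I_n) :
    power {i : 'I_n | i \in J} :=
  fun i => x (val i).

Definition closed_projections :=
  forall (n : nat) (C : set (power 'I_n)), tdef_power C -> closed C ->
  forall J : {set 'I_n}, closed (@project n J @` C).

(* the lattice D_T *)
Definition closed_tdef : set (set G) := [set X | closed X /\ tdef X].

Record invariant_mean (R : realType) (m : set G -> R) : Prop := InvariantMean {
  mean_ge0 : forall Y, closed_tdef Y -> (0 <= m Y)%R;
  mean_le1 : forall Y, closed_tdef Y -> (m Y <= 1)%R;
  mean_mono : forall Y Z, closed_tdef Y -> closed_tdef Z ->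
    Y `<=` Z -> (m Y <= m Z)%R;
  mean_set0 : m set0 = 0%R;
  mean_setT : m setT = 1%R;
  mean_setU : forall Y Z, closed_tdef Y -> closed_tdef Z ->
    m (Y `|` Z) = (m Y + m Z - m (Y `&` Z))%R;
  mean_translate : forall g Y, closed_tdef Y -> m (translate g Y) = m Y
}.

(** * Connected components *)

(* [A] plays the role of the small model M inside Ms. *)
Definition Aut_invariant (A : set Ms) (X : set G) :=
  forall s : Ms -> Ms, automorphism s -> (forall a, A a -> s a = a) ->
    [set s \o x | x in co @` X] = co @` X.

Definition is_least (P : set (set G)) (H : set G) :=
  P H /\ forall H', P H' -> H `<=` H'.

Definition is_G00 (A : set Ms) :=
  is_least [set H | [/\ subgroup H, bounded_index K H & tdef_over A H]].

Definition is_G000 (A : set Ms) :=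
  is_least [set H | [/\ subgroup H, bounded_index K H & Aut_invariant A H]].

End TypeDefinable.

(* Main.v *)
From Stdlib Require List.
From mathcomp Require Import all_boot all_order all_algebra.
From mathcomp Require Import all_classical all_reals topology function_spaces.
From mathcomp Require Import lra ring.
Require Import Defs.

Set Implicit Arguments.
Unset Strict Implicit.
Unset Printing Implicit Defensive.

Import Order.TTheory GRing.Theory Num.Theory.
Local Open Scope classical_set_scope.

(** Let P be closed, M-type-definable and wide, and Q a definable set containing
    P. For finite C in G(M) put B_C = \bigcap_(c in C) cQ. Wideness of P makes
    C = {1} "large" in a combinatorial sense which, unlike a bound on the mean,
    is definable: among any k translates of B_C, two have a large intersection,
    and so on along a finite list of integers k. Along a long chain of such C the
    mean of cl(B_C Q) cannot drop by a definite factor at every step, so for some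
    large C it barely changes from C to C u gC, for all g in G(M) in the definable
    generic set X of those g for which C u gC is still large. Hence a product of
    eight elements of X(M) cannot move Y = cl(B_C Q) off itself, and by
    elementarity X^8 is contained in cl(QQ) cl(QQ)^-1; that set being closed, it
    contains cl(X)^8. This is the Massicot-Wagner argument with definability built
    in. Iterating it with cl(X) in place of P gives, inside any definable set
    containing P^4, a decreasing sequence of definable generic sets whose
    intersection is an M-type-definable subgroup of bounded index, so that
    G00 is contained in P^4.

    Let D be the set of all g^-1 h with g, h of the same type over M. By
    compactness every definable V containing D is generic, so cl(V) is wide and
    G00 is contained in cl(V)^4; letting V shrink to D, G00 is contained in
    cl(D)^4, hence in cl(D^4). Finally D is contained in G000, by comparing both
    g and h with a realization of a coheir of their type. *)

(** * Cardinals *)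

Section Cardinals.
Local Open Scope card_scope.

(** Relations need no value outside A, whereas a function on all of T may fail to exist when U is
    empty. Choice extracts an injection from such a relation. *)
Lemma card_le_relP (T U : Type) (A : set T) (B : set U) :
  (A #<= B) <-> exists R : T -> U -> Prop,
    (forall x, A x -> exists2 y, B y & R x y) /\
    (forall x x' y, A x -> A x' -> R x y -> R x' y -> x = x').
Proof.
split=> [/card_leP[f]|[R [totR injR]]].
  exists (fun x y => exists a : A, val a = x /\ val (f a) = y); split.
    move=> x Ax; exists (val (f (SigSub (mem_set Ax)))); first exact: set_valP.
    by exists (SigSub (mem_set Ax)).
  move=> x x' y _ _ [a [<- <-]] [b [<- /val_inj fab]].
  by congr val; apply: inj (esym fab); rewrite inE.
have /choice[f fR] : forall a : A, exists b : B, R (val a) (val b).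
  move=> a; have [y By Ry] := totR _ (set_valP a).
  by exists (SigSub (mem_set By)).
have finj : {in [set: A] &, injective f}.
  move=> a b _ _ eab; apply: val_inj.
  apply: (injR _ _ (val (f a))); try exact: set_valP; first exact: fR.
  by rewrite eab; exact: fR.
have fT : {homo f : x / [set: A] x >-> [set: B] x} by [].
have [g _] := @funPinj _ _ [set: A] [set: B] (mkfun_fun fT) finj.
by apply/card_leP; squash g.
Qed.

Lemma card_le_inj (T U : Type) (A : set T) (B : set U) (f : T -> U) :
  (forall x, A x -> B (f x)) ->
  (forall x x', A x -> A x' -> f x = f x' -> x = x') -> A #<= B.
Proof.
move=> fB finj; apply/card_le_relP; exists (fun x y => f x = y); split.
  by move=> x Ax; exists (f x) => //; exact: fB.
by move=> x x' y Ax Ax' <- /esym; exact: finj.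
Qed.

Lemma card_le_total (T U : Type) (A : set T) (B : set U) :
  (A #<= B) \/ (B #<= A).
Proof.
pose P : set (set (T * U)) := [set g | forall p q, g p -> g q ->
  [/\ A p.1, B p.2 & p.1 = q.1 <-> p.2 = q.2]].
have [F FP Ftot|g [Pg gmax]] := @Zorn_bigcup _ P.
  move=> p q [X FX Xp] [Y FY Yq].
  have [XY|YX] := Ftot _ _ FX FY; first exact: (FP _ FY _ _ (XY _ Xp) Yq).
  exact: (FP _ FX _ _ Xp (YX _ Yq)).
have [Atot|] := pselect (forall x, A x -> exists y, g (x, y)).
  left; apply/card_le_relP; exists (fun x y => g (x, y)); split.
    by move=> x /Atot[y gy]; exists y => //; have [] := Pg _ _ gy gy.
  by move=> x x' y _ _ gx gx'; have [_ _ /= ->] := Pg _ _ gx gx'.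
have [Btot|] := pselect (forall y, B y -> exists x, g (x, y)).
  right; apply/card_le_relP; exists (fun y x => g (x, y)); split.
    by move=> y /Btot[x gx]; exists x => //; have [] := Pg _ _ gx gx.
  by move=> y y' x _ _ gy gy'; have [_ _ /= <-] := Pg _ _ gy gy'.
move=> /existsNP[y /not_implyP[By gy]] /existsNP[x /not_implyP[Ax gx]].
exfalso; apply: (gmax (g `|` [set (x, y)])).
  split; first by move=> p gp; left.
  by move=> /(_ (x, y) (or_intror erefl)) gxy; apply: gx; exists y.
move=> p q [gp|->] [gq|->] /=; first exact: Pg.
- have [Ap Bp _] := Pg _ _ gp gp; split => //; split=> e.
    by case: gx; exists p.2; rewrite -e -surjective_pairing.
  by case: gy; exists p.1; rewrite -e -surjective_pairing.
- have [Ap Bp _] := Pg _ _ gq gq; split => //; split=> e.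
    by case: gx; exists q.2; rewrite e -surjective_pairing.
  by case: gy; exists q.1; rewrite e -surjective_pairing.
- by [].
Qed.

(* Zorn's lemma for the bijections of Y * bool with Y, with Y included in A. *)
Lemma card_le_double (T : Type) (A : set T) :
  infinite_set A -> (A `*` [set: bool]) #<= A.
Proof.
move=> Ainf.
(* These are the values of g; the conditions in [P] make this the common set Y. *)
pose dom (g : set (T * bool * T)) := [set x | exists p, g (p, x)].
pose P : set (set (T * bool * T)) := [set g |
  (forall p q, g p -> g q -> p.1 = q.1 <-> p.2 = q.2) /\
  (forall p, g p -> [/\ A p.2, dom g p.1.1 & forall b, exists y, g ((p.2, b), y)])].
have [F FP Ftot|g [[ginj gdom] gmax]] := @Zorn_bigcup _ P.
  split.
    move=> p q [X FX Xp] [Y FY Yq].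
    have [XY|YX] := Ftot _ _ FX FY.
      by have [+ _] := FP _ FY; apply => //; exact: XY.
    by have [+ _] := FP _ FX; apply => //; exact: YX.
  move=> p [X FX Xp]; have [_ /(_ _ Xp)[Ap [q Xq] pX]] := FP _ FX; split => //.
    by exists q, X.
  by move=> b; have [y Xy] := pX b; exists y, X.
have YA : dom g `<=` A by move=> x [p gp]; have [] := gdom _ gp.
have dbl : (dom g `*` [set: bool]) #<= dom g.
  apply/card_le_relP; exists (fun p x => g (p, x)); split.
    move=> [x b] [/= [p gp] _]; have [_ _ /(_ b)[y gy]] := gdom _ gp.
    by exists y => //; exists (x, b).
  by move=> p q x _ _ gp gq; have /= [_ ->] := ginj _ _ gp gq.
(* By maximality: an infinite remainder would contain an injective sequence h, and sending (h n, b)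
   to h (2n + b) would extend g. *)
have fin : finite_set (A `\` dom g).
  apply: contrapT => /infiniteP/card_le_relP[R [Rtot Rinj]].
  have /choice[h hR] : forall n : nat, exists x, (A `\` dom g) x /\ R n x.
    by move=> n; have [x] := Rtot n I; exists x.
  have hinj n n' : h n = h n' -> n = n'.
    move=> e; apply: (Rinj _ _ (h n)) => //; first by have [] := hR n.
    by rewrite e; have [] := hR n'.
  pose g' : set (T * bool * T) :=
    [set p | exists (n : nat) (b : bool), p = ((h n, b), h (n.*2 + b)%N)].
  apply: (gmax (g `|` g')).
    split; first by move=> p gp; left.
    move=> sub; have gh : g ((h 0%N, false), h 0%N).
      by apply: sub; right; exists 0%N, false.
    by have [[_ +] _] := hR 0%N; apply; exists (h 0%N, false).
  have nb n b n' b' : (n.*2 + nat_of_bool b = n'.*2 + nat_of_bool b')%N ->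
    n = n' /\ b = b'.
    move=> e; have := congr1 odd e; rewrite !oddD !odd_double !oddb !addFb => eb.
    by move: e; rewrite eb => /addIn/double_inj.
  have gg' p q : g p -> g' q -> p.1 <> q.1 /\ p.2 <> q.2.
    move=> gp [n [b ->]]; have [Ap dp _] := gdom _ gp; split=> /= e.
      by have [[_ +] _] := hR n; apply; move: dp; rewrite e.
    have [[_ +] _] := hR (n.*2 + b)%N; apply; exists p.1.
    by rewrite -e -surjective_pairing.
  split.
    move=> p q [gp|gp] [gq|gq]; first exact: ginj.
    - by have [] := gg' _ _ gp gq.
    - by have [] := gg' _ _ gq gp; split => /esym.
    - move: gp gq => [n [b ->]] [n' [b' ->]] /=; split=> [[/hinj -> ->] //|].
      by move=> /hinj/nb[-> ->].
  move=> p [gp|[n [b ->]]] /=.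
    have [Ap [q gq] Ep] := gdom _ gp; split => //; first by exists q; left.
    by move=> b; have [y] := Ep b; exists y; left.
  split; first by have [[]] := hR (n.*2 + b)%N.
    exists (h n./2, odd n); right; exists n./2, (odd n).
    by rewrite addnC odd_double_half.
  by move=> b'; eexists; right; eexists _, b'.
(* The finite remainder embeds in [dom g], since A would be finite otherwise; hence A fits in two
   copies of [dom g]. *)
have Adom : A #<= (dom g `*` [set: bool]).
  have [le|le] := card_le_total (A `\` dom g) (dom g); last first.
    exfalso; apply: Ainf; rewrite (_ : A = (A `\` dom g) `|` dom g).
      by rewrite finite_setU; split => //; exact: card_le_finite fin.
    by rewrite setUC setDUK.
  have [R [Rtot Rinj]] := (card_le_relP _ _).1 le.
  apply/card_le_relP.
  exists (fun x p => dom g x /\ p = (x, true) \/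
     ~ dom g x /\ p.2 = false /\ R x p.1); split.
    move=> x Ax; have [dx|ndx] := pselect (dom g x).
      by exists (x, true) => //; left.
    by have [y dy Rxy] := Rtot x (conj Ax ndx); exists (y, false) => //; right.
  move=> x x' [y b] Ax Ax' [[dx [ey eb]]|[ndx [/= eb Rx]]]
     [[dx' [ey' eb']]|[ndx' [/= eb' Rx']]]; subst => //.
  exact: (Rinj _ _ y).
apply: (@card_le_trans _ _ _ (dom g `*` [set: bool])); last first.
  exact: card_le_trans dbl (subset_card_le YA).
have [R [Rtot Rinj]] := (card_le_relP _ _).1 (card_le_trans Adom dbl).
apply/card_le_relP; exists (fun p q => p.2 = q.2 /\ R p.1 q.1); split.
  by move=> [x b] [/= Ax _]; have [y dy Rxy] := Rtot x Ax; exists (y, b).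
move=> [x b] [x' b'] [y c] [/= Ax _] [/= Ax' _] [-> Rx] [-> Rx'].
by rewrite (Rinj _ _ _ Ax Ax' Rx Rx').
Qed.

(** A and the rest of B go to the two copies of C given by [card_le_double]. *)
Lemma card_leU (T U : Type) (A B : set T) (C : set U) :
  infinite_set C -> (A #<= C) -> (B #<= C) -> (A `|` B) #<= C.
Proof.
move=> Cinf /card_le_relP[R [Rtot Rinj]] /card_le_relP[S [Stot Sinj]].
apply: card_le_trans (card_le_double Cinf); apply/card_le_relP.
exists (fun x p => A x /\ p.2 = true /\ R x p.1 \/
     ~ A x /\ p.2 = false /\ S x p.1); split.
  move=> x ABx; have [Ax|nAx] := pselect (A x).
    by have [y Cy Rxy] := Rtot x Ax; exists (y, true) => //; left.
  case: ABx => // Bx; have [y Cy Rxy] := Stot x Bx.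
  by exists (y, false) => //; right.
move=> x x' [y b] ABx ABx' [[dx [/= eb Rx]]|[ndx [/= eb Rx]]]
  [[dx' [/= eb' Rx']]|[ndx' [/= eb' Rx']]]; subst => //.
  exact: (Rinj _ _ y).
by apply: (Sinj _ _ y) => //; [case: ABx|case: ABx'].
Qed.

Lemma small_le (K T U : Type) (A : set T) (B : set U) :
  small K B -> (A #<= B) -> small K A.
Proof.
move=> [BK KB] AB; split; first exact: card_le_trans BK.
by move=> KA; apply: KB; exact: card_le_trans AB.
Qed.

(** If K embeds in the union, the larger of the two sets is infinite, so by [card_leU] K embeds in
    that set already. *)
Lemma small_setU (K T : Type) (A B : set T) : infinite_set [set: K] ->
  small K A -> small K B -> small K (A `|` B).
Proof.
move=> Kinf [AK KA] [BK KB]; split; first exact: card_leU.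
have wlogAB (C D : set T) : ~ ([set: K] #<= D) -> (C #<= D) ->
    ~ ([set: K] #<= (C `|` D)).
  move=> KD CD KCD; apply: (KD).
  have Dinf : infinite_set D.
    move=> Dfin; apply: Kinf; apply: card_le_finite KCD _.
    by rewrite finite_setU; split => //; exact: card_le_finite Dfin.
  by apply: card_le_trans KCD _; apply: card_leU.
have [AB|BA] := card_le_total A B; first exact: wlogAB.
by rewrite setUC; exact: wlogAB.
Qed.

Lemma small_bigcup (K T : Type) (I : finType) (F : I -> set T) :
  infinite_set [set: K] -> (forall i, small K (F i)) ->
  small K [set x | exists i, F i x].
Proof.
move=> Kinf Fs.
suff H (s : seq I) : small K [set x | exists2 i, i \in s & F i x].
  rewrite (_ : [set x | _] = [set x | exists2 i, i \in enum I & F i x]) //.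
  apply/seteqP; split=> x; last by move=> [i _ Fx]; exists i.
  by move=> [i Fx]; exists i => //; rewrite mem_enum.
elim: s => [|i s IHs].
  rewrite (_ : [set x | _] = set0); last by apply/seteqP; split => x // [].
  split; first exact: card_ge0.
  by move=> /card_le0P K0; apply: Kinf; rewrite K0.
rewrite (_ : [set x | _] = F i `|` [set x | exists2 i, i \in s & F i x]).
  exact: small_setU.
apply/seteqP; split=> x.
  move=> [k]; rewrite inE => /orP[/eqP ->|ks] Fx; first by left.
  by right; exists k.
move=> [Fx|[k ks Fx]]; first by exists i; rewrite ?mem_head.
by exists k => //; rewrite inE ks orbT.
Qed.

End Cardinals.

(** * Formulas *)

Section Formulas.
Context (L : language).

Fixpoint trename (V W : Type) (f : V -> W) (t : term L V) : term L W :=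
  match t with
  | Tvar x => Tvar L (f x)
  | Tapp g u => Tapp (fun i => trename f (u i))
  end.

Fixpoint frename (V W : Type) (f : V -> W) (phi : form L V) : form L W :=
  match phi with
  | Fbot => Fbot _ _
  | Feq t u => Feq (trename f t) (trename f u)
  | Frel r t => Frel (fun i => trename f (t i))
  | Fimp phi psi => Fimp (frename f phi) (frename f psi)
  | Fall phi => Fall (frename (omap f) phi)
  end.

Definition Fnot (V : Type) (phi : form L V) := Fimp phi (Fbot _ _).
Definition Fand (V : Type) (phi psi : form L V) := Fnot (Fimp phi (Fnot psi)).
Definition Fands (V : Type) (s : seq (form L V)) := foldr (@Fand V) (Fnot (Fbot _ _)) s.

Lemma teval_trename (N : structure L) (V W : Type) (f : V -> W) (t : term L V)
  (v : W -> N) : teval v (trename f t) = teval (v \o f) t.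
Proof. by elim: t => //= g u IHu; congr fint; apply/funext => i. Qed.

Lemma sat_frename (N : structure L) (V W : Type) (f : V -> W) (phi : form L V)
  (v : W -> N) : sat (frename f phi) v = sat phi (v \o f).
Proof.
elim: phi W f v => {V} [V|V t u|V r t|V phi IH psi IHpsi|V phi IH] W f v //=.
- by rewrite !teval_trename.
- by congr rint; apply/funext => i; rewrite teval_trename.
- by rewrite IH IHpsi.
- apply/propext; split=> H a.
    by have := H a; rewrite IH; congr sat; apply/funext; case.
  by rewrite IH; have := H a; congr sat; apply/funext; case.
Qed.

Lemma sat_Fand (N : structure L) (V : Type) (phi psi : form L V) (v : V -> N) :
  sat (Fand phi psi) v <-> sat phi v /\ sat psi v.
Proof.
split=> /= [H|[Hp Hq] H]; last exact: H.
by split; apply: contrapT => H'; apply: H => // ? ?.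
Qed.

Lemma sat_Fands (N : structure L) (V I : Type) (s : seq I) (F : I -> form L V)
    (v : V -> N) :
  sat (Fands [seq F i | i <- s]) v <-> forall i, List.In i s -> sat (F i) v.
Proof.
elim: s => [|i s IHs]; first by split=> // _; exact.
split=> [/sat_Fand[Fi /IHs Fs] k [<-|/Fs]|H] //.
by apply/sat_Fand; split; [|apply/IHs => k ks]; apply: H; [left|right].
Qed.

Lemma term_finite_support (V : Type) (t : term L V) :
  exists s : seq V, forall (N : structure L) (v v' : V -> N),
    (forall x, List.In x s -> v x = v' x) -> teval v t = teval v' t.
Proof.
elim: t => [x|f u IH] /=.
  by exists [:: x] => N v v'; apply; left.
have /choice[s sP] := IH.
exists (flatten [seq s i | i <- enum 'I_(far f)]) => N v v' vv'.
congr fint; apply/funext => i; apply: sP => x xs; apply: vv'.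
have : i \in enum 'I_(far f) by rewrite mem_enum.
elim: (enum _) => //= k e IHe; rewrite inE => /orP[/eqP <-|/IHe H].
  by apply/List.in_app_iff; left.
by apply/List.in_app_iff; right.
Qed.

(** Membership is [List.In] because V need not have decidable equality. *)
Lemma form_finite_support (V : Type) (phi : form L V) :
  exists s : seq V, forall (N : structure L) (v v' : V -> N),
    (forall x, List.In x s -> v x = v' x) -> sat phi v = sat phi v'.
Proof.
elim: phi => {V} [V|V t u|V r t|V phi [s sP] psi [s' s'P]|V phi [s sP]] /=.
- by exists [::].
- have [s sP] := term_finite_support t; have [s' s'P] := term_finite_support u.
  exists (s ++ s') => N v v' vv'.
  by congr eq; [apply: sP|apply: s'P] => x xs; apply: vv';
    apply/List.in_app_iff; [left|right].
- have /choice[s sP] := fun i => term_finite_support (t i).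
  exists (flatten [seq s i | i <- enum 'I_(rar r)]) => N v v' vv'.
  congr rint; apply/funext => i; apply: sP => x xs; apply: vv'.
  have : i \in enum 'I_(rar r) by rewrite mem_enum.
  elim: (enum _) => //= k e IHe; rewrite inE => /orP[/eqP <-|/IHe H].
    by apply/List.in_app_iff; left.
  by apply/List.in_app_iff; right.
- exists (s ++ s') => N v v' vv'.
  by rewrite (sP N v v') ?(s'P N v v') // => x xs; apply: vv';
    apply/List.in_app_iff; [right|left].
(* This drops the bound variable [None] and keeps the free ones. *)
- exists (pmap id s) => N v v' vv'.
  suff E a : sat phi (oapp v a) = sat phi (oapp v' a).
    by apply/propext; split=> H a; [rewrite -E|rewrite E]; exact: H.
  apply: sP => -[x|] //= xs; apply: vv'.
  elim: s xs => //= -[y|] s IHs [] //=.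
  + by case=> ->; left.
  + by move/IHs; right.
Qed.

(** [elementary_embedding] speaks of variables in ['I_n] only; finite support allows an arbitrary V
    to be renamed into such a type. *)
Lemma elementary_embedding_form (N N' : structure L) (f : N -> N') (V : Type)
    (phi : form L V) (v : V -> N) :
  elementary_embedding f -> sat phi v <-> sat phi (f \o v).
Proof.
move=> fE; have [s sP] := form_finite_support phi.
have [[x0 _]|V0] := pselect (exists x : V, True); last first.
  have g : V -> 'I_0 by move=> x; exfalso; apply: V0; exists x.
  have g' : 'I_0 -> V by case.
  have E (M : structure L) (w : V -> M) : sat phi w = sat (frename g phi) (w \o g').
    by rewrite sat_frename; congr sat; apply/funext => x; exfalso; apply: V0; exists x.
  by rewrite !E; exact: fE.
(* The first position of x in s; the extra index [size s] receives the variables outside s. *)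
pose r (x : V) : 'I_(size s).+1 := inord (find (fun y => `[< x = y >]) s).
have E (M : structure L) (w : V -> M) :
    sat phi w = sat (frename r phi) (w \o (fun i : 'I__ => nth x0 s i)).
  rewrite sat_frename; apply: sP => x xs /=; congr w.
  have hx : has (fun y => `[< x = y >]) s.
    elim: s xs {r} => //= y s IHs [->|/IHs ->]; last by rewrite orbT.
    by rewrite asboolT.
  rewrite inordK; last by rewrite ltnS ltnW // -has_find.
  by have /asboolP := nth_find x0 hx.
by rewrite !E; exact: fE.
Qed.

Lemma automorphism_sat (N : structure L) (s : N -> N) (V : Type)
    (phi : form L V) (v : V -> N) :
  automorphism s -> sat phi v = sat phi (s \o v).
Proof.
move=> [[s' sK s'K] sf sr].
have sT (W : Type) (t : term L W) (w : W -> N) : s (teval w t) = teval (s \o w) t.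
  by elim: t => //= g u IH; rewrite sf; congr fint; apply/funext => i /=.
elim: phi v => {V} [V|V t u|V r t|V phi IH psi IHpsi|V phi IH] v //=.
- by rewrite -!sT; apply/propext; split=> [->//|/(can_inj sK)].
- have -> : (fun i => teval (s \o v) (t i)) = s \o (fun i => teval v (t i)).
    by apply/funext => i /=.
  exact/propext/sr.
- by rewrite IH IHpsi.
- have E a : s \o oapp v a = oapp (s \o v) (s a) by apply/funext; case.
  apply/propext; split=> H a; last by rewrite IH E.
  by have := H (s' a); rewrite IH E s'K.
Qed.

(** Elements of a sort are tuples of coordinates, while [Fall] binds one variable at a time.
    Enumerating W reduces to ['I_n], and each induction step turns the variable [ord0] into
    [None]. *)
Lemma forall_finite_block (V : Type) (W : finType)
    (phi : form L (V + W)) :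
  exists phi' : form L V, forall (N : structure L) (v : V -> N),
    sat phi' v <-> forall w : W -> N, sat phi (assign v w).
Proof.
suff H n (U : Type) (psi : form L (U + 'I_n)) : exists psi' : form L U,
    forall (N : structure L) (u : U -> N), sat psi' u <-> forall w : 'I_n ->
      N, sat psi (assign u w).
  pose r (x : V + W) : V + 'I_#|W| :=
    match x with inl x => inl x | inr x => inr (enum_rank x) end.
  have [phi' phi'E] := H _ _ (frename r phi).
  exists phi' => N v; rewrite phi'E; split=> H' w.
    have := H' (w \o enum_val); rewrite sat_frename; congr sat.
    by apply/funext => -[] //= x; rewrite enum_rankK.
  rewrite sat_frename; have := H' (w \o enum_rank).
  by congr sat; apply/funext => -[].
elim: n U psi => [|n IHn] U psi.
  pose r (x : U + 'I_0) : U :=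
    match x with inl x => x | inr x => let: Ordinal _ lt0 :=
      x in match notF lt0 with end end.
  exists (frename r psi) => N u; rewrite sat_frename.
  have E (w : 'I_0 -> N) : u \o r = assign u w.
    by apply/funext => -[x|[]].
  split=> [H w|H]; first by rewrite -E.
  have w0 : 'I_0 -> N by case.
  by rewrite (E w0).
pose r (x : U + 'I_n.+1) : option U + 'I_n :=
  match x with inl x => inl (Some x)
  | inr x => match unlift ord0 x with Some y => inr y | None => inl None end end.
have [psi' psi'E] := IHn _ (frename r psi).
exists (Fall psi') => N u /=; split=> H w.
  have /psi'E/(_ (w \o lift ord0)) := H (w ord0).
  rewrite sat_frename; congr sat; apply/funext => -[] //= x; rewrite /r.
  by case: unliftP => [y ->|->].
apply/psi'E => w'; rewrite sat_frename.
have := H (fun i => if unlift ord0 i is Some y then w' y else w).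
congr sat; apply/funext => -[] //= x; rewrite /r.
by case: (unlift ord0 x).
Qed.

End Formulas.

(** * Definable sets and saturation *)

Section Sorts.
Context (L : language) (N : structure L).

(* A sort is a type whose elements are faithfully given by their coordinates in N,
   the tuples of coordinates forming a set definable without parameters: N^n, the
   group, and the products and powers of these. *)
Record sort := Sort {
  scar :> Type;
  svar : finType;
  sco : scar -> svar -> N;
  sco_inj : injective sco;
  sdom : form L svar;
  sdomP : forall x, (exists s, sco s = x) <-> sat sdom x
}.

Program Definition tuple_sort (n : nat) : sort :=
  @Sort ('I_n -> N) _ id _ (Fnot (Fbot _ _)) _.
Next Obligation. by move=> n x y. Qed.
Next Obligation. by move=> n x; split=> [_|_]; [exact|exists x]. Qed.

Program Definition prod_sort (S S' : sort) : sort :=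
  @Sort (S * S')%type (svar S + svar S')%type
    (fun p => assign (sco p.1) (sco p.2)) _
    (Fand (frename inl (sdom S)) (frename inr (sdom S'))) _.
Next Obligation.
move=> S S' [a b] [a' b'] /= e; congr pair.
  by apply: sco_inj; apply/funext => v; have := congr1 (fun f => f (inl v)) e.
by apply: sco_inj; apply/funext => v; have := congr1 (fun f => f (inr v)) e.
Qed.
Next Obligation.
move=> S S' x; split.
  move=> [[a b] <-]; apply/sat_Fand; rewrite !sat_frename; split.
    by apply/sdomP; exists a.
  by apply/sdomP; exists b.
move=> /sat_Fand; rewrite !sat_frename => -[/sdomP[a ea] /sdomP[b eb]].
exists (a, b); apply/funext => -[v|v] /=; first by rewrite ea.
by rewrite eb.
Qed.

Canonical prod_sort.

Program Definition power_sort (n : nat) (S : sort) : sort :=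
  @Sort ('I_n -> S) ('I_n * svar S)%type (fun x p => sco (x p.1) p.2) _
    (Fands [seq frename (pair i) (sdom S) | i <- enum 'I_n]) _.
Next Obligation.
move=> n S x y e; apply/funext => i; apply: sco_inj; apply/funext => v.
exact: (congr1 (fun f => f (i, v)) e).
Qed.
Next Obligation.
move=> n S x; split.
  by move=> [y <-]; apply/sat_Fands => i _; rewrite sat_frename; apply/sdomP;
    exists (y i).
move=> /sat_Fands H.
have /choice[y yE] : forall i, exists s : S, sco s = x \o pair i.
  move=> i; apply/sdomP; rewrite -sat_frename; apply: H.
  have : i \in enum 'I_n by rewrite mem_enum.
  by elim: (enum _) => //= k e IH; rewrite inE => /orP[/eqP->|/IH]; [left|right].
by exists y; apply/funext => -[i v] /=; rewrite yE.
Qed.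

Definition definable (A : set N) (S : sort) (Q : S -> Prop) :=
  exists phi : form L (svar S + A),
    forall s, Q s <-> sat phi (assign (sco s) (@param _ A)).

Section Closure.
Context (A : set N).
Notation definable := (definable A).

Lemma definable_ext (S : sort) (Q Q' : S -> Prop) : (forall s, Q s <-> Q' s) ->
  definable Q -> definable Q'.
Proof. by move=> QQ' [phi H]; exists phi => s; rewrite -QQ'. Qed.

Lemma definable_False (S : sort) : definable (fun _ : S => False).
Proof. by exists (Fbot _ _). Qed.

Lemma definable_imp (S : sort) (P Q : S -> Prop) :
  definable P -> definable Q -> definable (fun s => P s -> Q s).
Proof. by move=> [p pE] [q qE]; exists (Fimp p q) => s /=; rewrite pE qE. Qed.

Lemma definable_not (S : sort) (P : S -> Prop) : definable P ->
  definable (fun s => ~ P s).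
Proof. by move=> ?; apply: definable_imp => //; exact: definable_False. Qed.

Lemma definable_True (S : sort) : definable (fun _ : S => True).
Proof. by apply: (definable_ext _ (definable_not (definable_False S))) => s;
  split=> // _; exact. Qed.

Lemma definable_and (S : sort) (P Q : S -> Prop) :
  definable P -> definable Q -> definable (fun s => P s /\ Q s).
Proof.
move=> dP dQ; apply: (definable_ext _ (definable_not (definable_imp dP (definable_not
  dQ)))) => s.
by rewrite not_implyE; split=> -[? ?]; split=> //; exact: contrapT.
Qed.

Lemma definable_or (S : sort) (P Q : S -> Prop) :
  definable P -> definable Q -> definable (fun s => P s \/ Q s).
Proof.
move=> dP dQ; apply: (definable_ext _ (definable_imp (definable_not dP) dQ)) => s.
by rewrite implyE notK.
Qed.

Lemma definable_iff (S : sort) (P Q : S -> Prop) :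
  definable P -> definable Q -> definable (fun s => P s <-> Q s).
Proof. by move=> dP dQ; apply: definable_and; exact: definable_imp. Qed.

(** Quantifying over a sort means quantifying over tuples of coordinates, relativized to [sdom]. *)
Lemma definable_forall (S S' : sort) (Q : prod_sort S S' -> Prop) :
  definable Q -> definable (fun s => forall s', Q (s, s')).
Proof.
move=> [phi phiE].
pose r (x : (svar S + svar S') + A) : (svar S + A) + svar S' :=
  match x with inl (inl v) => inl (inl v) | inl (inr v) => inr v | inr a => inl (inr a)
    end.
have [psi psiE] := forall_finite_block
  (Fimp (frename inr (sdom S')) (frename r phi)).
exists psi => s; rewrite psiE /=; split=> H w.
  rewrite !sat_frename => /sdomP[s' s'E].
  have /phiE := H s'; congr sat; apply/funext => -[[v|v]|a] //=.
  by rewrite s'E.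
apply/phiE; have := H (sco w); rewrite !sat_frename => /(_ _).
have -> : assign (sco (s, w)) (@param _ A) =
  assign (assign (sco s) (@param _ A)) (sco w) \o r by apply/funext => -[[]|].
by apply; apply/sdomP; exists w.
Qed.

Lemma definable_exists (S S' : sort) (Q : prod_sort S S' -> Prop) :
  definable Q -> definable (fun s => exists s', Q (s, s')).
Proof.
move=> dQ; apply: (definable_ext _ (definable_not (definable_forall (definable_not
  dQ)))) => s.
by rewrite -existsNE; split=> -[s' ?]; exists s' => //; exact: contrapT.
Qed.

Lemma definable_all (S : sort) (I : Type) (s : seq I) (Q : I -> S -> Prop) :
  (forall i, List.In i s -> definable (Q i)) ->
  definable (fun x => forall i, List.In i s -> Q i x).
Proof.
elim: s => [|i s IHs] H; first by apply: (definable_ext _ (definable_True S)).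
have di : definable (Q i) by apply: H; left.
have ds : definable (fun x => forall i, List.In i s -> Q i x).
  by apply: IHs => k ks; apply: H; right.
apply: (definable_ext _ (definable_and di ds)) => x; split=> [[Qi Qs] k [<-|/Qs]//|Qx].
by split=> [|k ks]; apply: Qx; [left|right].
Qed.

(** When each coordinate of f s is a coordinate of s or a parameter, composing with f is a mere
    renaming of variables. *)
Lemma definable_pull (S S' : sort) (f : S -> S') (r : svar S' -> svar S + A)
    (Q : S' -> Prop) :
  (forall s v, sco (f s) v = assign (sco s) (@param _ A) (r v)) ->
  definable Q -> definable (fun s => Q (f s)).
Proof.
move=> fr [phi phiE].
exists (frename (fun x => match x with inl v => r v | inr a => inr a end) phi) => s.
rewrite phiE sat_frename; have -> // : assign (sco (f s)) (@param _ A) =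
  assign (sco s) (@param _ A) \o
    (fun x : svar S' + A => match x with inl v => r v | inr a => inr a end).
by apply/funext => -[v|a] //=; rewrite fr.
Qed.

(* Defined by pullbacks rather than by the graph, so that composition and pairing
   require no quantifier; see [definable_fun_graph]. *)
Definition definable_fun (S S' : sort) (f : S -> S') := forall (T : sort) (Q :
  prod_sort S' T -> Prop),
  definable Q -> definable (fun p : prod_sort S T => Q (f p.1, p.2)).

Lemma definable_fun_pull (S S' : sort) (f : S -> S') (r : svar S' -> svar S + A) :
  (forall s v, sco (f s) v = assign (sco s) (@param _ A) (r v)) -> definable_fun f.
Proof.
move=> fr T Q; apply: (definable_pull (S' := prod_sort S' T) (f := fun p :
  prod_sort S T => (f p.1, p.2))
  (r := fun x => match x with
     | inl v => match r v with inl u => inl (inl u) | inr a => inr a end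
     | inr v => inl (inr v) end)) => -[s t] [v|v] //=.
by rewrite fr; case: (r v).
Qed.

Lemma definable_fun_id (S : sort) : definable_fun (fun s : S => s).
Proof. exact: (definable_fun_pull (r := inl)). Qed.

Lemma definable_fun_comp (S S' S'' : sort) (g : S' -> S'') (f : S -> S') :
  definable_fun g -> definable_fun f -> definable_fun (fun s => g (f s)).
Proof. by move=> dg df T Q /dg /df. Qed.

Lemma definable_fun_fst (S S' : sort) : definable_fun (fst : prod_sort S S' -> S).
Proof. by apply: (definable_fun_pull (S := prod_sort S S') (r :=
  fun v => inl (inl v))) => -[]. Qed.

Lemma definable_fun_snd (S S' : sort) : definable_fun (snd : prod_sort S S' -> S').
Proof. by apply: (definable_fun_pull (S := prod_sort S S') (r :=
  fun v => inl (inr v))) => -[]. Qed.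

Lemma definable_fun_coord (n : nat) (S : sort) (i : 'I_n) :
  definable_fun ((fun x => x i) : power_sort n S -> S).
Proof. by apply: (definable_fun_pull (S := power_sort n S) (r :=
  fun v => inl (i, v))). Qed.

Lemma definable_fun_cst (S S' : sort) (s' : S') :
  (forall v, A (sco s' v)) -> definable_fun (fun _ : S => s').
Proof.
move=> As'; apply: (definable_fun_pull (r :=
  fun v => inr (SigSub (mem_set (As' v))))) => //.
Qed.

Lemma definable_comp (S S' : sort) (f : S -> S') (Q : S' -> Prop) :
  definable_fun f -> definable Q -> definable (fun s => Q (f s)).
Proof.
move=> df dQ.
have dQ1 : definable (fun p : prod_sort S' S => Q p.1).
  by apply: (definable_pull (S := prod_sort S' S) (r := fun v => inl (inl v))) dQ => -[].
apply: (definable_pull (f := fun s => ((s, s) : prod_sort S S))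
  (r := fun x => match x with inl v => inl v | inr v => inl v end)) (df _ _ dQ1).
by move=> s [].
Qed.

Lemma definable_fun_pair (S S1 S2 : sort) (f : S -> S1) (g : S -> S2) :
  definable_fun f -> definable_fun g -> definable_fun (fun s => (f s, g s) :
    prod_sort S1 S2).
Proof.
move=> df dg T Q dQ.
have dQ1 : definable (fun p : prod_sort S1 (prod_sort S2 T) => Q ((p.1, p.2.1), p.2.2)).
  apply: (definable_pull (f := fun p : prod_sort S1 (prod_sort S2 T) =>
    ((p.1, p.2.1), p.2.2) : prod_sort (prod_sort S1 S2) T)
    (r := fun x => match x with inl (inl v) => inl (inl v)
      | inl (inr v) => inl (inr (inl v)) | inr v => inl (inr (inr v)) end)) dQ.
  by move=> p [[]|].
have dQ2 : definable (fun p : prod_sort S2 (prod_sort S T) => Q ((f p.2.1, p.1), p.2.2)).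
  apply: (definable_pull (f := fun p : prod_sort S2 (prod_sort S T) =>
    (p.2.1, (p.1, p.2.2)) : prod_sort S (prod_sort S2 T))
    (r := fun x => match x with inl v => inl (inr (inl v))
      | inr (inl v) => inl (inl v) | inr (inr v) => inl (inr (inr v)) end)) (df _ _ dQ1).
  by move=> p [|[]].
apply: (definable_pull (f := fun p : prod_sort S T =>
    (p.1, p) : prod_sort S (prod_sort S T))
    (r := fun x => match x with inl v => inl (inl v) | inr v => inl v end)) (dg _ _ dQ2).
by move=> p [v|[v|v]].
Qed.

Lemma definable_comp2 (S S1 S2 : sort) (f : S -> S1) (g : S -> S2)
    (Q : prod_sort S1 S2 -> Prop) :
  definable_fun f -> definable_fun g -> definable Q -> definable (fun s => Q (f s, g s)).
Proof. by move=> df dg; apply: definable_comp; exact: definable_fun_pair. Qed.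

Lemma definable_eq (S : sort) : definable (fun p : prod_sort S S => p.1 = p.2).
Proof.
exists (Fands [seq Feq (Tvar L (inl (inl v))) (Tvar L (inl (inr v))) | v <- enum (svar
  S)]).
move=> [s t]; rewrite sat_Fands /=; split=> [->//|H]; apply: sco_inj.
apply/funext => v; apply: H; have : v \in enum (svar S) by rewrite mem_enum.
by elim: (enum _) => //= k e IH; rewrite inE => /orP[/eqP->|/IH]; [left|right].
Qed.

Lemma definable_fun_graph (S S' : sort) (f : S -> S') :
  definable (fun p : prod_sort S S' => f p.1 = p.2) -> definable_fun f.
Proof.
move=> dG T Q dQ.
have d1 : definable (fun p : prod_sort (prod_sort S T) S' => f p.1.1 = p.2).
  apply: (definable_comp2 (Q := fun p : prod_sort S S' => f p.1 = p.2) _ _ dG).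
    exact: definable_fun_comp (@definable_fun_fst _ _) (@definable_fun_fst _ _).
  exact: definable_fun_snd.
have d2 : definable (fun p : prod_sort (prod_sort S T) S' => Q (p.2, p.1.2)).
  apply: (definable_comp2 (Q := Q)) => //; first exact: definable_fun_snd.
  exact: definable_fun_comp (@definable_fun_snd _ _) (@definable_fun_fst _ _).
apply: (definable_ext _ (definable_exists (definable_and d1 d2))) => -[s t] /=.
by split=> [[y [<-]]//|Qs]; exists (f s).
Qed.

End Closure.

Lemma definable_sub (A B : set N) (S : sort) (Q : S -> Prop) :
  A `<=` B -> definable A Q -> definable B Q.
Proof.
move=> AB [phi phiE].
exists (frename (fun x => match x with inl v => inl v
  | inr a => inr (SigSub (mem_set (AB _ (set_valP a)))) end) phi) => s.
rewrite phiE sat_frename; have -> // : assign (sco s) (@param _ A) =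
  assign (sco s) (@param _ B) \o (fun x : svar S + A => match x with inl v => inl v
  | inr a => inr (SigSub (mem_set (AB _ (set_valP a)))) end).
by apply/funext => -[].
Qed.

Lemma definable_section (A : set N) (S S' : sort) (s' : S') (Q : prod_sort S S' -> Prop) :
  definable A Q -> definable (A `|` range (sco s')) (fun s => Q (s, s')).
Proof.
move=> dQ; apply: (definable_comp2 (f := fun s => s) (g := fun=> s')).
- exact: definable_fun_id.
- by apply: definable_fun_cst => v; right; exists v.
- by apply: definable_sub dQ; exact: subsetUl.
Qed.

End Sorts.

Lemma finite_set_list (T : Type) (F : set T) :
  finite_set F -> exists s : seq T, forall x, List.In x s <-> F x.
Proof.
move=> [n] /card_eqPle[/card_le_relP[R [Rtot Rinj]] _].
exists (pmap (fun i => if pselect (exists x, F x /\ R x i) is left e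
   then Some (projT1 (cid e)) else None) (iota 0 n)) => x; split.
  elim: (iota 0 n) => //= i s IHs; case: pselect => //= e [<-|//].
  by case: (cid e) => y [].
move=> Fx; have [i /= ilt Rxi] := Rtot x Fx.
have : i \in iota 0 n by rewrite mem_iota.
elim: (iota 0 n) => //= k s IHs; rewrite inE => /orP[/eqP <-|/IHs].
  case: pselect => [e|[]]; last by exists x.
  by left; case: (cid e) => y [Fy Ry] /=; exact: Rinj Ry Rxi.
by case: pselect => //= e ?; right.
Qed.

Section Saturation.
Context (K : Type) (L : language) (N : structure L).
Hypothesis satN : saturated K N.

(** Saturation for definable subsets of a sort, so that formulas need not be handled afterwards. *)
Lemma saturation (A : set N) (S : sort N) (F : set (S -> Prop)) : small K A ->
  (forall Q, F Q -> definable A Q) ->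
  (forall s, (forall Q, List.In Q s -> F Q) -> exists x, forall Q, List.In Q s -> Q x) ->
  exists x, forall Q, F Q -> Q x.
Proof.
move=> smA dF finF; pose n := #|svar S|.
(* The case [True] forces the realizing tuple to be the coordinates of an element of S, even when F
   is empty. *)
pose Sig : set (form L ('I_n + A)) := [set psi | exists2 Q, F Q \/ Q = (fun=> True) &
  forall x : 'I_n -> N, sat psi (assign x (@param _ A)) <-> exists2 s, sco s = x \o
    enum_rank & Q s].
have SigQ (Q : S -> Prop) : definable A Q -> exists psi : form L ('I_n + A),
    forall x : 'I_n -> N, sat psi (assign x (@param _ A)) <-> exists2 s, sco s = x \o
      enum_rank & Q s.
  move=> [phi phiE].
  pose r (v : svar S + A) : 'I_n + A :=
    match v with inl v => inl (enum_rank v) | inr a => inr a end.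
  exists (frename r (Fand (frename inl (sdom S)) phi)) => x.
  rewrite sat_frename sat_Fand sat_frename.
  have E s : sco s = x \o enum_rank ->
    assign (sco s) (@param _ A) = assign x (@param _ A) \o r.
    by move=> e; apply/funext => -[v|a] //=; rewrite e.
  split; last first.
    move=> [s e Qs]; split; last by rewrite -(E s e); exact/phiE.
    by apply/sdomP; exists s.
  move=> [/sdomP[s e] sphi]; exists s => //.
  by apply/phiE; rewrite (E s e).
have [F' F'fin F'S|x xP] := satN (S := Sig) smA.
  have [s sP] := finite_set_list F'fin.
  have [l [lF lP]] : exists l : seq (S -> Prop), (forall Q, List.In Q l -> F Q) /\
     forall x : 'I_n -> N, (exists2 t, sco t = x \o enum_rank &
       forall Q, List.In Q l -> Q t) ->
        forall phi, List.In phi s -> sat phi (assign x (@param _ A)).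
    have sS phi : List.In phi s -> Sig phi by move=> /sP/F'S.
    elim: s sS {sP} => [|phi s IHs] sS; first by exists [::].
    have [|l [lF lP]] := IHs; first by move=> psi ps; apply: sS; right.
    have [|Q FQ QE] := sS phi; first by left.
    case: FQ QE => [FQ|->] QE.
      exists (Q :: l); split; first by move=> Q' [<-//|/lF].
      move=> x [t tx tQ] psi [<-|/lP]; last by apply; exists t => // Q' ?; apply: tQ;
        right.
      by apply/QE; exists t => //; apply: tQ; left.
    exists l; split => // x [t tx tQ] psi [<-|/lP]; last by apply; exists t.
    by apply/QE; exists t.
  have [t tP] := finF l lF; exists (sco t \o enum_val) => phi /sP; apply: lP.
  by exists t => //; apply/funext => v /=; rewrite enum_rankK.
have [psi0 psi0E] := SigQ _ (definable_True A S).
have [|s0 s0x _] := (psi0E x).1.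
  by apply: xP; exists (fun=> True) => //; right.
exists s0 => Q FQ; have [psi psiE] := SigQ _ (dF _ FQ).
have [|s sx Qs] := (psiE x).1; first by apply: xP; exists Q => //; left.
by have <- : s = s0 by apply: sco_inj; rewrite sx s0x.
Qed.

End Saturation.

(** * Topological groups *)

Section SetProducts.
Context (G : groupType).
Implicit Types (A B X Y : set G) (x y g : G).

Lemma translateE g X : translate g X = (fun x => g^-1 * x)%g @^-1` X.
Proof.
apply/seteqP; split=> [_ [x Xx <-]|x /= Xx]; first by rewrite /= mulKg.
by exists (g^-1 * x)%g => //; rewrite mulVKg.
Qed.

Lemma inv_setE X : inv_set X = (fun x => x^-1)%g @^-1` X.
Proof.
apply/seteqP; split=> [_ [x Xx <-]|x /= Xx]; first by rewrite /= invgK.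
by exists x^-1%g => //; rewrite invgK.
Qed.

Lemma mul_setE A B : mul_set A B = [set x | exists2 a, A a & B (a^-1 * x)%g].
Proof.
apply/seteqP; split=> [_ [a Aa [b Bb <-]]|x [a Aa Bx]].
  by exists a => //; rewrite mulKg.
by exists a => //; exists (a^-1 * x)%g => //; rewrite mulVKg.
Qed.

Lemma mul_setI A B x y : A x -> B y -> mul_set A B (x * y)%g.
Proof. by move=> Ax By; exists x => //; exists y. Qed.

Lemma mul_setS A A' B B' : A `<=` A' -> B `<=` B' -> mul_set A B `<=` mul_set A' B'.
Proof. by move=> AA BB _ [a /AA Aa [b /BB Bb <-]]; exact: mul_setI. Qed.

End SetProducts.

Section TopologicalGroups.
Context (G : topGroupType).
Implicit Types (A B X Y : set G) (x y g : G).

Lemma continuous_mulg (S : topologicalType) (f g : S -> G) :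
  continuous f -> continuous g -> continuous (fun s => f s * g s)%g.
Proof.
move=> cf cg s; apply: (@continuous2_cvg _ _ _ _ _ _ _ _ (fun x y :
  G => (x * y)%g)) => //.
- exact: (@mulg_continuous G (f s, g s)).
- exact: cf.
- exact: cg.
Qed.

Lemma continuous_invg (S : topologicalType) (f : S -> G) :
  continuous f -> continuous (fun s => (f s)^-1)%g.
Proof.
move=> cf s; exact: (continuous_comp (cf s) (@invg_continuous G (f s))).
Qed.

Lemma closed_preimage (S S' : topologicalType) (f : S -> S') (C : set S') :
  continuous f -> closed C -> closed (f @^-1` C).
Proof. by move/continuous_closedP; apply. Qed.

Lemma closure_image (S S' : topologicalType) (f : S -> S') (X : set S) (x : S) :
  continuous f -> closure X x -> closure (f @` X) (f x).
Proof.
by move=> cf Xx B /cf/Xx[y [Xy By]]; exists (f y); split=> //; exists y.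
Qed.

Lemma closed_translate g X : closed X -> closed (translate g X).
Proof.
rewrite translateE; apply: closed_preimage; apply: continuous_mulg => x.
  exact: cvg_cst.
exact: cvg_id.
Qed.

Lemma closed_inv_set X : closed X -> closed (inv_set X).
Proof.
by rewrite inv_setE; apply: closed_preimage; apply: continuous_invg => x; exact: cvg_id.
Qed.

(** One factor at a time, left and right translations being continuous. *)
Lemma closure_mul A B : mul_set (closure A) (closure B) `<=` closure (mul_set A B).
Proof.
move=> _ [a Aa [b Bb <-]].
have H1 a' : A a' -> closure (mul_set A B) (a' * b)%g.
  move=> Aa'; have cf : continuous (fun x => a' * x)%g.
    by apply: continuous_mulg => x; [exact: cvg_cst|exact: cvg_id].
  apply: (closureS _ (closure_image cf Bb)) => _ [b' Bb' <-].
  exact: mul_setI.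
have cf : continuous (fun x => x * b)%g.
  by apply: continuous_mulg => x; [exact: cvg_id|exact: cvg_cst].
rewrite ((closure_id _).1 (@closed_closure _ (mul_set A B))).
by apply: (closureS _ (closure_image cf Aa)) => _ [a' /H1 ? <-].
Qed.

Lemma closure_inv A : inv_set (closure A) `<=` closure (inv_set A).
Proof.
move=> _ [a Aa <-]; apply: (@closure_image G G (fun x : G => x^-1)%g) => //.
by apply: continuous_invg => x; exact: cvg_id.
Qed.

Lemma closure_translate g A : translate g (closure A) = closure (translate g A).
Proof.
have H h X : translate h (closure X) `<=` closure (translate h X).
  move=> _ [a Aa <-]; apply: (@closure_image G G (fun x : G => h * x)%g) => //.
  by apply: continuous_mulg => x; [exact: cvg_cst|exact: cvg_id].
apply/seteqP; split; first exact: H.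
move=> x Ax; exists (g^-1 * x)%g; last by rewrite mulVKg.
have : translate g^-1%g (closure (translate g A)) (g^-1 * x)%g by exists x.
move=> /H; apply: closureS => _ [_ [a Aa <-] <-].
by rewrite mulKg.
Qed.

Lemma continuous_power (S : topologicalType) (I : Type) (f : S -> power G I) :
  (forall i, continuous (fun s => f s i)) -> continuous f.
Proof.
move=> cf s; apply/cvg_sup => i U [V [[W oW <-] Wfs] VU].
apply: (@filterS _ _ _ ((fun s => f s i) @^-1` W)); first by move=> t /VU.
by apply: (cf i s); apply: open_nbhs_nbhs; split.
Qed.

End TopologicalGroups.

(** * Large intersections of translates *)

Section LargeIntersections.
Context (G : groupType).

(** The intersection of the translates cX for c in C. *)
Definition inter (X : set G) (C : seq G) : set G :=
  [set x | forall c, List.In c C -> X (c^-1 * x)%g].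

(* A definable substitute for a lower bound on the mean of [inter X C]; the list
   bounds the numbers of translates considered at the successive stages. *)
Fixpoint large (X : set G) (ks : seq nat) (C : seq G) : Prop :=
  match ks with
  | [::] => inter X C !=set0
  | k :: ks' => forall g : 'I_k -> G, exists a b : 'I_k, a != b /\
      large X ks' ([seq (g a * c)%g | c <- C] ++ [seq (g b * c)%g | c <- C])
  end.

Lemma List_In_map (U V : Type) (f : U -> V) (s : seq U) (y : V) :
  List.In y [seq f x | x <- s] <-> exists2 x, List.In x s & f x = y.
Proof.
by split=> [/List.in_map_iff[x [<- xs]]|[x xs <-]]; [exists x|apply/List.in_map_iff;
  exists x].
Qed.

Lemma interU (X : set G) (C C' : seq G) : inter X (C ++ C') = inter X C `&` inter X C'.
Proof.
apply/seteqP; split=> [x H|x [H H'] c /List.in_app_iff[]]; [|exact: H|exact: H'].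
by split=> c cC; apply: H; apply/List.in_app_iff; [left|right].
Qed.

Lemma inter_translate (X : set G) (g : G) (C : seq G) :
  inter X [seq (g * c)%g | c <- C] = translate g (inter X C).
Proof.
apply/seteqP; split=> [x H|_ [x H <-] _ /List_In_map[c cC <-]].
  exists (g^-1 * x)%g; last by rewrite mulVKg.
  by move=> c cC; rewrite mulgA -invgM; apply: H; apply/List_In_map; exists c.
by rewrite invgM -mulgA mulKg; exact: H.
Qed.

Lemma largeS (X : set G) ks C C' :
  (forall c, List.In c C -> List.In c C') -> large X ks C' -> large X ks C.
Proof.
elim: ks C C' => [|k ks IH] C C' CC' /=.
  by move=> [x H]; exists x => c /CC'; exact: H.
move=> H g; have [a [b [ab lab]]] := H g; exists a, b; split=> //.
apply: IH lab => c /List.in_app_iff[] /List_In_map[y /CC' yC <-]; apply/List.in_app_iff.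
  by left; apply/List_In_map; exists y.
by right; apply/List_In_map; exists y.
Qed.

Lemma large_translate (X : set G) ks C (h : G) :
  large X ks C -> large X ks [seq (h * c)%g | c <- C].
Proof.
case: ks => [|k ks] /=.
  by rewrite inter_translate => -[x Cx]; exists (h * x)%g; exists x.
move=> H g; have [a [b [ab lab]]] := H (fun i => g i * h)%g; exists a, b; split=> //.
have E i : [seq (g i * c)%g | c <- [seq (h * c)%g | c <- C]] =
    [seq (g i * h * c)%g | c <- C].
  by rewrite -map_comp; apply: eq_map => c /=; rewrite mulgA.
by rewrite !E.
Qed.

(** Translating by the inverse of [g a] turns the union of the two translates of C into the union of
    C and one translate of it. In this form largeness yields generic sets. *)
Lemma large_return (X : set G) k ks C (g : 'I_k -> G) : large X (k :: ks) C ->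
  exists a b : 'I_k, a != b /\
    large X ks (C ++ [seq ((g a)^-1 * g b * c)%g | c <- C]).
Proof.
move=> /(_ g)[a [b [ab lab]]]; exists a, b; split=> //.
have := large_translate (g a)^-1%g lab; rewrite map_cat -!map_comp.
congr large; congr (_ ++ _); last by apply: eq_map => c /=; rewrite mulgA.
by rewrite -[RHS]map_id; apply: eq_map => c /=; rewrite mulKg.
Qed.

Lemma large_nonempty (X : set G) ks C : all (ltn 0) ks -> large X ks C ->
  inter X C !=set0.
Proof.
elim: ks C => [//|k ks IH] C /= /andP[k0 kspos] /(_ (fun=> 1%g))[a [b [_ lab]]].
apply: IH => //; apply: largeS lab => c cC; apply/List.in_app_iff; left.
by apply/List_In_map; exists c => //; rewrite mul1g.
Qed.

Fixpoint setpow (n : nat) (X : set G) : set G :=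
  if n is n'.+1 then mul_set X (setpow n' X) else [set 1%g].

Definition mul4 (P : set G) : set G :=
  mul_set (mul_set (mul_set P P) (inv_set P)) (inv_set P).

(** The reason for the exponent 8: four factors for each of a and b. The last factor is multiplied
    by 1 because [setpow] ends with 1. *)
Lemma mul4_quotient (P : set G) (a b : G) : (forall x, P x -> P x^-1%g) ->
  mul4 P a -> mul4 P b -> setpow 8 P (a^-1 * b)%g.
Proof.
move=> PV.
move=> [_ [_ [x1 P1 [x2 P2 <-]] [_ [x3 P3 <-] <-]] [_ [x4 P4 <-] <-]].
move=> [_ [_ [y1 Q1 [y2 Q2 <-]] [_ [y3 Q3 <-] <-]] [_ [y4 Q4 <-] <-]].
rewrite !invgM !invgK -!mulgA.
do ![apply: mul_setI; first by [|exact: PV]].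
rewrite -[_^-1%g]mulg1; apply: mul_setI => //; exact: PV.
Qed.

End LargeIntersections.

(** * Definability over the small model *)

Section MonsterGroup.
Context (K : Type) (L : language) (M Ms : structure L) (j : M -> Ms)
    (d : nat) (Gm : group_formulas L d) (T : formula_family L d)
    (G : topGroupType) (co : G -> 'I_d -> Ms).
Hypotheses (Klarge : sufficiently_large K M) (satMs : saturated K Ms)
  (homMs : strongly_homogeneous K Ms) (jE : elementary_embedding j)
  (topG : induced_topology Gm T co)
  (projG : closed_projections K co).

Let intG : interprets Gm co := induced_interprets topG.

Lemma group_domP (x : 'I_d -> Ms) : (exists g, co g = x) <-> sat (gdom Gm) x.
Proof.
have /seteqP[AB BA] := co_range intG.
split=> [[g <-]|/BA[g _ <-]]; last by exists g.
by apply: AB; exists g.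
Qed.

Definition Gsort : sort Ms := Sort (co_inj intG) group_domP.

Notation Mdef := (definable (range j)).
Notation Mfun := (definable_fun (range j)).

Lemma small_types (U : Type) (A : set U) :
  (A #<= [set: set (form L (nat + M))])%card -> small K A.
Proof. exact: small_le Klarge. Qed.

(** An element of M or a coordinate of u is coded by the singleton of the formula v = v in its own
    variable v, which embeds the union into the sets of formulas bounded by [sufficiently_large]. *)
Lemma small_params (W : finType) (u : W -> Ms) : small K (range j `|` range u).
Proof.
apply: small_types; apply/card_le_relP.
pose a v : form L (nat + M) := Feq (Tvar L v) (Tvar L v).
exists (fun y X => (exists2 m, j m = y & X = [set a (inr m)]) \/
  (exists2 w, u w = y & X = [set a (inl (nat_of_ord (enum_rank w)))])).
have ainj v w : [set a v] = [set a w] -> v = w.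
  by move=> /seteqP[/(_ (a v) erefl) []].
split=> [y [[m _ <-]|[w _ <-]]|y y' X _ _].
- by exists [set a (inr m)] => //; left; exists m.
- by exists [set a (inl (nat_of_ord (enum_rank w)))] => //; right; exists w.
- case=> [[m <- ->]|[w <- ->]] [[m' <- /ainj]|[w' <- /ainj]] //.
    by case=> ->.
  by case=> /val_inj/enum_rank_inj ->.
Qed.

Lemma small_M : small K (range j).
Proof.
apply: small_le (small_params (fun x : 'I_0 => match notF (ltn_ord x) with end)) _.
by apply: subset_card_le; exact: subsetUl.
Qed.

Lemma K_infinite : infinite_set [set: K].
Proof.
move=> Kfin; have [+ _] := Klarge; move=> /(card_le_finite)/(_ Kfin).
apply/infiniteP; apply: (@card_le_inj _ _ _ _ (fun n : nat =>
  [set Feq (Tvar L (inl n : nat + M)) (Tvar L (inl n))])) => // m n _ _.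
by move=> /seteqP[/(_ _ erefl) []].
Qed.

(** * Points of the small model and type-definability over it *)

Definition Mpoint (S : sort Ms) (s : S) := forall v, range j (sco s v).

(** The Tarski-Vaught property of M. Parameters are pulled back along [j], and the existence of a
    solution, a formula over M, is reflected by elementarity. For [Gsort] the points found are those
    of G(M). *)
Lemma Mpoint_exists (S : sort Ms) (Q : S -> Prop) :
  Mdef Q -> (exists s, Q s) -> exists2 s, Q s & Mpoint s.
Proof.
move=> [phi phiE] [s0 Qs0].
have /choice[pre preE] : forall a : range j, exists m, j m = val a.
  by move=> a; have [m _ me] := set_valP a; exists m.
pose r (v : svar S + range j) : M + svar S :=
  match v with inl v => inr v | inr a => inl (pre a) end.
pose theta := Fand (frename inr (sdom S)) (frename r phi).
have [psi psiE] := forall_finite_block (Fnot theta).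
have : ~ sat psi (fun m : M => m).
  move=> /(elementary_embedding_form _ _ jE)/psiE/(_ (sco s0)); apply.
  apply/sat_Fand; rewrite !sat_frename; split; first by apply/sdomP; exists s0.
  have -> : assign (j \o id) (sco s0) \o r = assign (sco s0) (@param _ (range j)).
    by apply/funext => -[v|a] //=; rewrite preE.
  exact/phiE.
rewrite psiE => /existsNP[w /contrapT wP].
have := (elementary_embedding_form theta (assign (fun m => m) w) jE).1 wP.
move=> /sat_Fand; rewrite !sat_frename => -[/sdomP[s sE] /=].
have -> : (j \o assign (fun m => m) w) \o r = assign (sco s) (@param _ (range j)).
  by apply/funext => -[v|a] /=; [rewrite sE|rewrite preE].
by move=> /phiE Qs; exists s => // v; rewrite sE; exists (w v).
Qed.

Lemma Mpoint_forall (S : sort Ms) (Q : S -> Prop) :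
  Mdef Q -> (forall s, Mpoint s -> Q s) -> forall s, Q s.
Proof.
move=> dQ QM s; apply: contrapT => nQ.
have [|t nQt Mt] := Mpoint_exists (definable_not dQ); first by exists s.
by apply: nQt; exact: QM.
Qed.

(** The singleton of f s is definable over M, hence contains a point of M. *)
Lemma Mpoint_fun (S S' : sort Ms) (f : S -> S') (s : S) :
  Mfun f -> Mpoint s -> Mpoint (f s).
Proof.
move=> df Ms_s.
have dE : Mdef (fun t => f s = t).
  apply: (definable_comp2 (f := fun=> f s) (g := fun t => t) (Q := fun p => p.1 = p.2)).
  - by apply: definable_fun_comp (definable_fun_cst _ Ms_s); exact: df.
  - exact: definable_fun_id.
  - exact: definable_eq.
by have [|t <-] := Mpoint_exists dE; first by exists (f s).
Qed.

(* Type-definability over M as the property of being the intersection of one's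
   M-definable supersets; see [MtdefP]. *)
Definition Mtdef (S : sort Ms) (X : set S) :=
  forall s, (forall Q : set S, Mdef Q -> X `<=` Q -> Q s) -> X s.

Lemma Mtdef_definable (S : sort Ms) (Q : set S) : Mdef Q -> Mtdef Q.
Proof. by move=> dQ s; apply. Qed.

Lemma Mtdef_bigcap (S : sort Ms) (I : Type) (P : set I) (F : I -> set S) :
  (forall i, P i -> Mtdef (F i)) -> Mtdef (\bigcap_(i in P) F i).
Proof.
move=> tF s H i Pi; apply: tF => // Q dQ FQ; apply: H => // t Ft.
by apply: FQ; exact: Ft.
Qed.

Lemma Mtdef_setI (S : sort Ms) (X Y : set S) : Mtdef X -> Mtdef Y -> Mtdef (X `&` Y).
Proof.
move=> tX tY s H; split; [apply: tX|apply: tY] => Q dQ sub; apply: H => // t [? ?];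
  exact: sub.
Qed.

Lemma Mtdef_setU (S : sort Ms) (X Y : set S) : Mtdef X -> Mtdef Y -> Mtdef (X `|` Y).
Proof.
move=> tX tY s H; have [Xs|nX] := pselect (X s); first by left.
right; apply: tY => Q dQ YQ; apply: contrapT => nQs; apply: nX; apply: tX => Q' dQ' XQ'.
by have [|//|//] := H _ (definable_or dQ' dQ); move=> t [/XQ'|/YQ]; [left|right].
Qed.

Lemma Mtdef_pull (S S' : sort Ms) (f : S -> S') (X : set S') :
  Mfun f -> Mtdef X -> Mtdef (f @^-1` X).
Proof.
move=> df tX s H; apply: tX => Q dQ XQ; apply: (H _ (definable_comp df dQ)).
by move=> t; exact: XQ.
Qed.

Lemma MtdefP (S : sort Ms) (X : set S) :
  type_definable_over (range j) (@sco _ _ S @` X) <-> Mtdef X.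
Proof.
split=> [[Sig /seteqP[XS SX]] s H|tX].
  have [|s' Xs' /sco_inj <- //] := SX (sco s).
  move=> phi Sphi; have dphi : Mdef (fun s :
    S => sat phi (assign (sco s) (@param _ (range j)))).
    by exists phi.
  apply: (H _ dphi) => t Xt; apply: (XS (sco t)) => //; by exists t.
(* All formulas over M true on X; the domain formula of the sort is among them, so every realization
   is an element of S. *)
exists [set phi | forall s, X s -> sat phi (assign (sco s) (@param _ (range j)))].
apply/seteqP; split=> [_ [s Xs <-] phi|x xP]; first exact.
have : sat (frename inl (sdom S)) (assign x (@param _ (range j))).
  by apply: xP => s _; rewrite sat_frename; apply/sdomP; exists s.
rewrite sat_frename => /sdomP[s sE]; exists s => //; apply: tX => Q [phi phiE] XQ.
by apply/phiE; rewrite sE; apply: xP => t /XQ /phiE.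
Qed.

(** Only the coordinates of s' are added to the parameters from M, so smallness is kept while s' may
    lie outside M, as the parameter of a basic neighborhood does. *)
Lemma compactness (S S' : sort Ms) (s' : S') (I : Type) (W : I -> set S)
    (R : prod_sort S S' -> Prop) :
  inhabited I -> (forall i, Mtdef (W i)) ->
  (forall i i', exists k, W k `<=` W i `&` W i') -> Mdef R ->
  (forall i, exists2 s, W i s & R (s, s')) ->
  exists2 s, (forall i, W i s) & R (s, s').
Proof.
move=> [i0] tW dirW dR WR.
pose F : set (S -> Prop) := [set Q | definable (range j `|` range (sco s')) Q /\
  exists i, W i `&` (fun s => R (s, s')) `<=` Q].
have [Q [//]| |s sF] := saturation satMs (F := F) (small_params (sco s')).
  move=> l lF; suff [i iP] : exists i, forall Q, List.In Q l ->
      W i `&` (fun s => R (s, s')) `<=` Q.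
    by have [s Wis Rs] := WR i; exists s => Q /iP; apply.
  elim: l lF => [|Q l IHl] lF; first by exists i0.
  have [|i iP] := IHl; first by move=> Q' Q'l; apply: lF; right.
  have [|_ [i' i'P]] := lF Q; first by left.
  have [k kP] := dirW i i'; exists k => Q' [<- s [/kP[_ Ws] Rs]|/iP QP s [/kP[Ws _] Rs]].
    exact: i'P.
  exact: QP.
exists s.
  move=> i; apply: tW => Q dQ WQ; apply: sF; split.
    by apply: definable_sub dQ; exact: subsetUl.
  by exists i => t [/WQ].
apply: (sF (fun t => R (t, s'))); split; first exact: definable_section.
by exists i0 => t [].
Qed.

Definition dsup (S : sort Ms) (X : set S) := {Q : set S | Mdef Q /\ X `<=` Q}.

Definition dsup_mk (S : sort Ms) (X Q : set S) (dQ : Mdef Q) (XQ : X `<=` Q) : dsup X :=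
  exist _ Q (conj dQ XQ).

Lemma dsup_inhabited (S : sort Ms) (X : set S) : inhabited (dsup X).
Proof. by constructor; exists setT; split=> //; exact: definable_True. Qed.

Lemma dsup_dir (S : sort Ms) (X : set S) (Q Q' : dsup X) :
  exists Q'' : dsup X, sval Q'' `<=` sval Q `&` sval Q'.
Proof.
case: Q Q' => [Q [dQ XQ]] [Q' [dQ' XQ']].
have XQQ' : X `<=` Q `&` Q' by move=> s Xs; split; [exact: XQ|exact: XQ'].
by exists (dsup_mk (definable_and dQ dQ') XQQ').
Qed.

(** Compactness for the directed family of the M-definable supersets of X. *)
Lemma Mtdef_sep (S S' : sort Ms) (s' : S') (X : set S) (R : prod_sort S S' -> Prop) :
  Mtdef X -> Mdef R ->
  (forall Q : set S, Mdef Q -> X `<=` Q -> exists2 s, Q s & R (s, s')) ->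
  exists2 s, X s & R (s, s').
Proof.
move=> tX dR XR.
have [|||s sX Rs] := @compactness _ _ s' (dsup X) sval _ (dsup_inhabited X) _ _ dR.
- by move=> [Q [dQ XQ]]; exact: Mtdef_definable.
- exact: dsup_dir.
- by move=> [Q [dQ XQ]]; exact: XR.
- by exists s => //; apply: tX => Q dQ XQ; exact: (sX (dsup_mk dQ XQ)).
Qed.

(** By compactness the existential quantifier commutes with the intersection of the M-definable
    supersets; the relation used is equality of the second coordinate with s'. *)
Lemma Mtdef_proj (S S' : sort Ms) (X : set (prod_sort S S')) :
  Mtdef X -> Mtdef [set s' | exists s, X (s, s')].
Proof.
move=> tX s' H.
have dR : Mdef (fun p : prod_sort (prod_sort S S') S' => p.1.2 = p.2).
  apply: (definable_comp2 (f := fun p : prod_sort (prod_sort S S') S' => p.1.2) (g := snd)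
     (Q := fun p => p.1 = p.2)).
  - exact: definable_fun_comp (@definable_fun_snd _ _ _ _ _) (@definable_fun_fst _ _ _
    _ _).
  - exact: definable_fun_snd.
  - exact: definable_eq.
have [|[s t] Xst /= <-] := Mtdef_sep (s' := s') tX dR; last by exists s.
move=> Q dQ XQ.
have dE : Mdef (fun s' => exists s, Q (s, s')).
  apply: (definable_exists (Q := fun p : prod_sort S' S => Q (p.2, p.1))).
  by apply: definable_comp2 dQ; [exact: definable_fun_snd|exact: definable_fun_fst].
have [|s Qs] := H _ dE; first by move=> t [s Xst]; exists s; exact: XQ.
by exists (s, s').
Qed.

(** * The definable group *)

Lemma Mdef_mulg_graph :
  Mdef (fun p : prod_sort (prod_sort Gsort Gsort) Gsort => (p.1.1 * p.1.2)%g = p.2).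
Proof.
exists (frename inl (gmul Gm)) => -[[x y] z]; rewrite sat_frename.
exact: co_mul intG x y z.
Qed.

Lemma Mfun_mulg (S : sort Ms) (f g : S -> Gsort) :
  Mfun f -> Mfun g -> Mfun (fun s => (f s * g s)%g : Gsort).
Proof.
move=> df dg.
have dm : Mfun (fun p : prod_sort Gsort Gsort => (p.1 * p.2)%g : Gsort).
  by apply: definable_fun_graph; exact: Mdef_mulg_graph.
exact: definable_fun_comp dm (definable_fun_pair df dg).
Qed.

(** 1 is the only idempotent of a group, which makes it definable. *)
Lemma Mpoint1 : Mpoint (1%g : Gsort).
Proof.
have d1 : Mdef (fun x : Gsort => (x * x)%g = x).
  apply: (definable_comp2 (f := fun x : Gsort => (x * x)%g : Gsort) (g := fun x => x)
    (Q := fun p => p.1 = p.2)).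
  - by apply: Mfun_mulg; exact: definable_fun_id.
  - exact: definable_fun_id.
  - exact: definable_eq.
have [|x xx Mx] := Mpoint_exists d1; first by exists 1%g; rewrite mulg1.
suff <- : x = 1%g by [].
by apply: (mulgI x); rewrite xx mulg1.
Qed.

Lemma Mfun_invg (S : sort Ms) (f : S -> Gsort) :
  Mfun f -> Mfun (fun s => (f s)^-1%g : Gsort).
Proof.
apply: definable_fun_comp; apply: definable_fun_graph.
have dE : Mdef (fun p : prod_sort Gsort Gsort => (p.1 * p.2)%g = 1%g).
  apply: (definable_comp2 (f := fun p : prod_sort Gsort Gsort => (p.1 * p.2)%g : Gsort)
    (g := fun=> (1%g : Gsort)) (Q := fun p => p.1 = p.2)).
  - by apply: Mfun_mulg; [exact: definable_fun_fst|exact: definable_fun_snd].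
  - exact: (definable_fun_cst _ Mpoint1).
  - exact: definable_eq.
apply: definable_ext dE => -[x y] /=; split=> [xy|<-]; last by rewrite mulgV.
by apply: (mulgI x); rewrite xy mulgV.
Qed.

Lemma MpointM (x y : Gsort) : Mpoint x -> Mpoint y -> Mpoint (x * y : Gsort)%g.
Proof.
move=> Mx My; apply: (@Mpoint_fun Gsort Gsort (fun y => x * y : Gsort)%g) => //.
by apply: Mfun_mulg; [exact: definable_fun_cst|exact: definable_fun_id].
Qed.

Lemma MpointV (x : Gsort) : Mpoint x -> Mpoint (x^-1%g : Gsort).
Proof.
by apply: (@Mpoint_fun Gsort Gsort (fun y => y^-1 : Gsort)%g); apply: Mfun_invg;
  exact: definable_fun_id.
Qed.

Lemma Mtdef_mul_set (X Y : set Gsort) : Mtdef X -> Mtdef Y -> Mtdef (mul_set X Y :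
  set Gsort).
Proof.
move=> tX tY; rewrite mul_setE.
have tW : Mtdef [set p : prod_sort Gsort Gsort | X p.1 /\ Y (p.1^-1 * p.2)%g].
  apply: Mtdef_setI.
    by apply: (@Mtdef_pull (prod_sort Gsort Gsort) Gsort fst);
      first exact: definable_fun_fst.
  apply: (@Mtdef_pull (prod_sort Gsort Gsort) Gsort (fun p => p.1^-1 * p.2 :
    Gsort)%g) => //.
  apply: Mfun_mulg; last exact: definable_fun_snd.
  by apply: Mfun_invg; exact: definable_fun_fst.
by move: (Mtdef_proj tW); congr Mtdef; apply/seteqP; split=> [x [a [Xa Yx]]|x [a Xa Yx]];
   exists a.
Qed.

Lemma Mtdef_inv_set (X : set Gsort) : Mtdef X -> Mtdef (inv_set X : set Gsort).
Proof.
rewrite inv_setE; apply: (@Mtdef_pull Gsort Gsort (fun x => x^-1 : Gsort)%g).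
by apply: Mfun_invg; exact: definable_fun_id.
Qed.

Lemma Mtdef_translate (g : Gsort) (X : set Gsort) : Mpoint g -> Mtdef X ->
  Mtdef (translate g X : set Gsort).
Proof.
move=> Mg; rewrite translateE; apply: (@Mtdef_pull Gsort Gsort (fun x => g^-1 * x :
  Gsort)%g).
apply: Mfun_mulg; last exact: definable_fun_id.
by apply: definable_fun_cst; exact: MpointV.
Qed.

(** * Closures of type-definable sets *)

Let YS (i : vidx T) := tuple_sort Ms (varity i).
Definition basic (i : vidx T) (y : YS i) : set G :=
  [set g | sat (vform i) (assign (co g) y)].

Lemma Mdef_basic (S : sort Ms) (i : vidx T) (f : S -> Gsort) (h : S -> YS i) :
  Mfun f -> Mfun h -> Mdef (fun s => basic (h s) (f s)).
Proof.
move=> df dh; apply: (definable_comp2 (Q := fun p :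
  prod_sort Gsort (YS i) => basic p.2 p.1) df dh).
by exists (frename inl (vform i)) => -[x y]; rewrite sat_frename.
Qed.

(** For U basic, the sets x U^-1 form a base of neighborhoods of x, and q is in x U^-1 exactly when
    q^-1 x is in U. *)
Lemma closure_basic (X : set G) (x : G) :
  closure X x <-> forall (i : vidx T) (y : YS i), exists2 q, X q & basic y (q^-1 * x)%g.
Proof.
split=> [Xx i y|H V Vx].
  have U1 : nbhs (1%g : G) (basic y) by apply: (induced_nbhs topG); exists i, y.
  have cf : continuous (fun q => q^-1 * x : G)%g.
    apply: continuous_mulg => z; last exact: cvg_cst.
    by apply: continuous_invg => w; exact: cvg_id.
  have : nbhs x (fun q : G => basic y (q^-1 * x)%g).
    by apply: (cf x); rewrite mulVg.
  by move=> /Xx[q [Xq Uq]]; exists q.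
have cf : continuous (fun u => x * u^-1 : G)%g.
  apply: continuous_mulg => z; first exact: cvg_cst.
  by apply: continuous_invg => w; exact: cvg_id.
have : nbhs (1%g : G) (fun u : G => V (x * u^-1)%g).
  by apply: (cf 1%g); rewrite invg1 mulg1.
move=> /(induced_basis topG)[_ [i [y ->]] UV].
have [q Xq Uq] := H i y; exists q; split=> //.
by have := UV _ Uq; rewrite invgM invgK mulVKg.
Qed.

(* Quantifying over the parameter of the basic neighborhood keeps this set
   definable over M. *)
Definition approx (Q : set G) (i : vidx T) : set G :=
  [set x | forall y : YS i, exists2 q, Q q & basic y (q^-1 * x)%g].

Lemma Mdef_approx (Q : set Gsort) (i : vidx T) : Mdef Q -> Mdef (approx Q i : set Gsort).
Proof.
move=> dQ.
pose S := prod_sort (prod_sort Gsort (YS i)) Gsort.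
have d1 : Mfun (fun p : S => p.1.1 : Gsort).
  exact: definable_fun_comp (@definable_fun_fst _ _ _ _ _) (@definable_fun_fst _ _ _ _ _).
have d2 : Mfun (fun p : S => p.1.2 : YS i).
  exact: definable_fun_comp (@definable_fun_snd _ _ _ _ _) (@definable_fun_fst _ _ _ _ _).
have d3 : Mfun (fun p : S => p.2 : Gsort) by exact: definable_fun_snd.
have d4 : Mdef (fun p : S => Q p.2 /\ basic p.1.2 (p.2^-1 * p.1.1)%g).
  apply: definable_and; first exact: definable_comp d3 dQ.
  by apply: Mdef_basic => //; apply: Mfun_mulg => //; exact: Mfun_invg.
apply: definable_ext (definable_forall (definable_exists d4)) => x.
by split=> H y; have [q] := H y; [move=> [Qq Uq]; exists q|exists q].
Qed.

Lemma closure_approx (X : set G) (x : G) : closure X x <-> forall i, approx X i x.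
Proof. exact: closure_basic. Qed.

(** Closure commutes with the intersection of the M-definable supersets: for a fixed neighborhood of
    x this is compactness, x and the parameter of the neighborhood being the fixed point s'. *)
Lemma closure_Mtdef (X : set Gsort) (x : Gsort) : Mtdef X ->
  (forall Q : set Gsort, Mdef Q -> X `<=` Q -> closure Q x) -> closure X x.
Proof.
move=> tX H; apply/closure_basic => i y.
apply: (Mtdef_sep (s' := (x, y)) (R := fun p : prod_sort Gsort (prod_sort Gsort (YS i)) =>
  basic p.2.2 (p.1^-1 * p.2.1)%g)) => //.
  apply: Mdef_basic.
    apply: Mfun_mulg; first by apply: Mfun_invg; exact: definable_fun_fst.
    exact: definable_fun_comp (@definable_fun_fst _ _ _ _ _) (@definable_fun_snd _ _ _
      _ _).
  exact: definable_fun_comp (@definable_fun_snd _ _ _ _ _) (@definable_fun_snd _ _ _ _ _).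
by move=> Q dQ XQ; exact: (closure_basic _ _).1 (H Q dQ XQ) i y.
Qed.

(** The closure of an M-definable Q is the intersection of the M-definable sets [approx Q i];
    [closure_Mtdef] reduces the general case to this one. *)
Lemma Mtdef_closure (X : set Gsort) : Mtdef X -> Mtdef (closure X : set Gsort).
Proof.
move=> tX x H; apply: closure_Mtdef => // Q dQ XQ; apply/closure_approx => i.
apply: H; first exact: Mdef_approx.
by move=> z Xz; have /closure_approx := closureS XQ Xz; exact.
Qed.

(** The assumption on projections enters the proof here. *)
Lemma closed_mul_set (X Y : set Gsort) : Mtdef X -> Mtdef Y -> closed (X : set G) ->
  closed (Y : set G) -> closed (mul_set X Y : set G).
Proof.
move=> tX tY cX cY; pose i0 : 'I_2 := ord0; pose i1 : 'I_2 := ord_max.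
have coordc (i : 'I_2) : continuous (fun p : power G 'I_2 => p i).
  exact: proj_continuous.
pose C : set (power G 'I_2) := [set p | X (p i0) /\ Y ((p i0)^-1 * p i1)%g].
have cC : closed C.
  apply: closedI; first exact: (closed_preimage (coordc i0)).
  apply: (@closed_preimage _ _ (fun p : power G 'I_2 => (p i0)^-1 * p i1 : G)%g) => //.
  by apply: continuous_mulg; [apply: continuous_invg|]; exact: coordc.
have tC : tdef_power K co C.
  exists (range j); first exact: small_M.
  apply: (@MtdefP (power_sort 2 Gsort) C).2.
  apply: Mtdef_setI.
    by apply: (@Mtdef_pull (power_sort 2 Gsort) Gsort (fun p => p i0));
      first exact: definable_fun_coord.
  apply: (@Mtdef_pull (power_sort 2 Gsort) Gsort (fun p => (p i0)^-1 * p i1 :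
    Gsort)%g) => //.
  by apply: Mfun_mulg; [apply: Mfun_invg|]; exact: definable_fun_coord.
(* The product XY is the projection of {(x, y) | x in X, x^-1 y in Y}. *)
have cP := @projG 2 C tC cC [set i1]%SET.
(* [project] takes values in a power indexed by a singleton; constant families identify G with it
   continuously. *)
pose diag (x : G) : power G {i : 'I_2 | i \in [set i1]%SET} := fun=> x.
have cdiag : continuous diag by apply: continuous_power => i x; exact: cvg_id.
suff -> : mul_set X Y = diag @^-1` (@project _ 2 [set i1]%SET @` C).
  exact: closed_preimage cdiag cP.
rewrite mul_setE; apply/seteqP; split=> x /=.
  move=> [a Xa Yx]; exists (fun i => if i == i0 then a else x); first by [].
  apply/funext => -[i ii1]; rewrite /project /diag /=.
  by move: (ii1); rewrite inE => /eqP ->.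
move=> [p [Xp Yp] px]; exists (p i0) => //; suff <- : p i1 = x by [].
have i1P : i1 \in [set i1]%SET by rewrite inE.
exact: (congr1 (fun f => f (exist _ i1 i1P)) px).
Qed.

(** * Definability of largeness, transfer to G(M) and genericity *)

Lemma Mdef_ex (S : sort Ms) (I : Type) (s : seq I) (Q : I -> S -> Prop) :
  (forall i, List.In i s -> Mdef (Q i)) ->
  Mdef (fun x => exists2 i, List.In i s & Q i x).
Proof.
move=> dQ; have := definable_not (@definable_all _ _ _ S I s (fun i x => ~ Q i x) (fun
  i si => definable_not (dQ i si))).
apply: definable_ext => x; split=> [|[i si Qi] H]; last exact: (H i si).
move=> /existsNP[i /not_implyP[si /contrapT Qi]]; by exists i.
Qed.

Lemma Mdef_ex_fin (S : sort Ms) (I : finType) (Q : I -> S -> Prop) :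
  (forall i, Mdef (Q i)) -> Mdef (fun x => exists i, Q i x).
Proof.
move=> dQ; apply: definable_ext (Mdef_ex (s := enum I) (fun i _ => dQ i)) => x.
split=> [[i _ Qi]|[i Qi]]; first by exists i.
exists i => //; have : i \in enum I by rewrite mem_enum.
by elim: (enum I) => //= k l IH; rewrite inE => /orP[/eqP->|/IH]; [left|right].
Qed.

Lemma Mdef_cst (S : sort Ms) (P : Prop) : Mdef (fun _ : S => P).
Proof.
by have [p|p] := pselect P;
  [apply: definable_ext (definable_True _ S)|apply: definable_ext (definable_False _ S)].
Qed.

(** The elements of C are functions of s because the recursion multiplies them by the quantified
    elements [g a]; the quantifier over g ranges over the sort [power_sort k Gsort]. *)
Lemma Mdef_large (Q : set Gsort) (S : sort Ms) ks (ts : seq (S -> Gsort)) : Mdef Q ->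
  (forall t, List.In t ts -> Mfun t) ->
  Mdef (fun s => large (Q : set G) ks [seq t s | t <- ts]).
Proof.
move=> dQ; elim: ks S ts => [|k ks IH] S ts dts /=.
  have dA : Mdef (fun p : prod_sort S Gsort =>
      forall t, List.In t ts -> Q ((t p.1)^-1 * p.2)%g).
    apply: definable_all => t tts; apply: (definable_comp _ dQ); apply: Mfun_mulg;
      last exact: definable_fun_snd.
    by apply: Mfun_invg; apply: definable_fun_comp (dts _ tts) _;
      exact: definable_fun_fst.
  apply: definable_ext (definable_exists dA) => s; split=> -[x Hx]; exists x.
    by move=> _ /List_In_map[t tts <-]; exact: Hx.
  by move=> t tts; apply: Hx; apply/List_In_map; exists t.
pose S' := prod_sort S (power_sort k Gsort).
pose us (a : 'I_k) : seq (S' -> Gsort) := [seq (fun p => p.2 a * t p.1 :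
  Gsort)%g | t <- ts].
have dus a t : List.In t (us a) -> Mfun t.
  move=> /List_In_map[u uts <-]; apply: Mfun_mulg.
    exact: definable_fun_comp (@definable_fun_coord _ _ _ _ _ a) (@definable_fun_snd _
      _ _ _ _).
  exact: definable_fun_comp (dts _ uts) (@definable_fun_fst _ _ _ _ _).
have dB : Mdef (fun p : S' => exists a b : 'I_k, a != b /\
    large (Q : set G) ks [seq t p | t <- us a ++ us b]).
  apply: Mdef_ex_fin => a; apply: Mdef_ex_fin => b; apply: definable_and;
    first exact: Mdef_cst.
  by apply: IH => t /List.in_app_iff[]; exact: dus.
apply: definable_ext (definable_forall dB) => s.
have E g a b : [seq t (s, g) | t <- us a ++ us b] =
  [seq (g a * c)%g | c <- [seq t s | t <- ts]] ++ [seq (g b * c)%g | c <- [seq t s | t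
    <- ts]].
  by rewrite map_cat -!map_comp.
by split=> H g; have [a [b [ab lab]]] := H g; exists a, b; [rewrite -E|rewrite E].
Qed.

Lemma Mdef_inter (Q : set Gsort) (C : seq Gsort) : Mdef Q ->
  (forall c, List.In c C -> Mpoint c) -> Mdef (inter (Q : set G) C : set Gsort).
Proof.
move=> dQ CM; apply: definable_all => c cC; apply: (definable_comp _ dQ).
by apply: Mfun_mulg; [apply: definable_fun_cst;
  exact: MpointV (CM _ cC)|exact: definable_fun_id].
Qed.

Lemma Mdef_mul_set (X Y : set Gsort) : Mdef X -> Mdef Y -> Mdef (mul_set X Y : set Gsort).
Proof.
move=> dX dY; rewrite mul_setE.
have dA : Mdef (fun p : prod_sort Gsort Gsort => X p.2 /\ Y (p.2^-1 * p.1)%g).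
  apply: definable_and; first by apply: (definable_comp _ dX); exact: definable_fun_snd.
  apply: (definable_comp _ dY); apply: Mfun_mulg; last exact: definable_fun_fst.
  by apply: Mfun_invg; exact: definable_fun_snd.
by apply: definable_ext (definable_exists dA) => x; split=> [[a []]|[a]]; exists a.
Qed.

Lemma Mdef_setpow n (X : set Gsort) : Mdef X -> Mdef (setpow n (X : set G) : set Gsort).
Proof.
move=> dX; elim: n => [|n IHn]; last exact: Mdef_mul_set.
apply: (definable_comp2 (f := fun x : Gsort => x) (g := fun=> (1%g : Gsort)) (Q :=
  fun p => p.1 = p.2)).
- exact: definable_fun_id.
- exact: (definable_fun_cst _ Mpoint1).
- exact: definable_eq.
Qed.

(** One factor at a time: for a first factor x in G(M), the induction hypothesis applies to the
    M-definable set x^-1 Q, and the resulting property of x is M-definable, hence holds throughout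
    X. *)
Lemma setpow_transfer n (X Q : set Gsort) : Mdef X -> Mdef Q ->
  setpow n (X `&` Mpoint (S := Gsort) : set G) `<=` Q -> setpow n (X : set G) `<=` Q.
Proof.
move=> dX; elim: n Q => [|n IHn] Q dQ XQ //.
suff H : forall x : Gsort, X x -> forall w, setpow n (X : set G) w -> Q (x * w)%g.
  by move=> _ [x Xx [w Xw <-]]; exact: H.
have dpw : Mdef (fun p : prod_sort Gsort Gsort => setpow n (X : set G) p.2 ->
  Q (p.1 * p.2)%g).
  apply: definable_imp; first by apply: (definable_comp _ (Mdef_setpow n dX));
    exact: definable_fun_snd.
  by apply: (definable_comp _ dQ); apply: Mfun_mulg;
    [exact: definable_fun_fst|exact: definable_fun_snd].
apply: Mpoint_forall; first exact: definable_imp dX (definable_forall dpw).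
move=> x Mx Xx; apply: (IHn (fun w => Q (x * w)%g)).
  by apply: (definable_comp _ dQ); apply: Mfun_mulg;
    [exact: definable_fun_cst|exact: definable_fun_id].
by move=> w Xw; apply: XQ; exists x => //; exists w.
Qed.

(** If no finite subset of G(M) covers, each finite one misses a point of G(M), non-covering being
    definable over M. Adding such points greedily gives k of them no two of which are related by X,
    against the hypothesis. *)
Lemma generic_cover (X : set Gsort) k : Mdef X ->
  (forall g : 'I_k -> G, exists a b, a != b /\ X ((g a)^-1 * g b)%g) ->
  exists F : seq Gsort, (forall f, List.In f F -> Mpoint f) /\
    forall g : Gsort, exists2 f, List.In f F & (X (f^-1 * g) \/ X (g^-1 * f))%g.
Proof.
move=> dX sepX; apply: contrapT => noF.
pose bad (f g : Gsort) := ~ (X (f^-1 * g)%g \/ X (g^-1 * f)%g).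
have step (F : seq Gsort) : (forall f, List.In f F -> Mpoint f) ->
    exists2 g : Gsort, Mpoint g & forall f, List.In f F -> bad f g.
  move=> FM; apply: contrapT => nog; apply: noF; exists F; split=> //.
  apply: Mpoint_forall.
    apply: Mdef_ex => f fF; apply: definable_or; apply: (definable_comp _ dX);
      apply: Mfun_mulg.
    - exact: definable_fun_cst (MpointV (FM _ fF)).
    - exact: definable_fun_id.
    - by apply: Mfun_invg; exact: definable_fun_id.
    - exact: definable_fun_cst (FM _ fF).
  move=> g Mg; apply: contrapT => nocov; apply: nog; exists g => // f fF Xf.
  by apply: nocov; exists f.
have [l [lk lM lbad]] : exists l : seq Gsort, [/\ size l = k, forall f, List.In f l ->
  Mpoint f &
    forall a b : nat, (a < b < k)%N -> bad (nth (1%g : G) l a) (nth (1%g : G) l b)].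
  elim: k {sepX} => [|k [l [lk lM lbad]]]; first by exists [::]; split=> // a b;
    rewrite ltn0 andbF.
  have [g Mg gbad] := step l lM; exists (rcons l g); split.
  - by rewrite size_rcons lk.
  - by move=> f; rewrite -cats1 => /List.in_app_iff[/lM//|[<-|]].
  - move=> a b /andP[ab]; rewrite ltnS leq_eqVlt => /orP[/eqP bk|bk].
      rewrite !nth_rcons lk -bk ab eqxx ltnn; apply: gbad.
      rewrite bk -lk in ab.
      elim: l a ab {bk lk lM lbad} => //= x l IHl [|a] al; first by left.
      by right; exact: IHl.
    have ak : (a < k)%N by exact: ltn_trans bk.
    by rewrite !nth_rcons lk ak bk; apply: lbad; rewrite ab.
have [a [b [ab Xab]]] := sepX (fun i => nth (1%g : G) l i).
have [lt|gt|/val_inj e] := ltngtP (val a) (val b); last by rewrite e eqxx in ab.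
  by apply: (lbad a b); [rewrite lt /=|left].
by apply: (lbad b a); [rewrite gt /=|right].
Qed.

(** Compactness over pairs of supersets. *)
Lemma Mtdef_sep2 (X Y : set Gsort) (R : prod_sort Gsort Gsort -> Prop) : Mtdef X ->
  Mtdef Y -> Mdef R ->
  (forall x y, X x -> Y y -> R (x, y)) ->
  exists X' Y' : set Gsort, [/\ Mdef X', Mdef Y', X `<=` X', Y `<=` Y' &
    forall x y, X' x -> Y' y -> R (x, y)].
Proof.
move=> tX tY dR XYR; apply: contrapT => noXY.
pose W (p : dsup X * dsup Y) : set (prod_sort Gsort Gsort) :=
  [set q | sval p.1 q.1 /\ sval p.2 q.2].
have [|||||[x y] Wxy] :=
  (* Here 1 is a dummy, the relation depending on its first argument only. *)
  @compactness (prod_sort Gsort Gsort) Gsort 1%g _ W (fun p => ~ R p.1).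
- have [X0] := dsup_inhabited X; have [Y0] := dsup_inhabited Y.
  by constructor; exact: (X0, Y0).
- move=> [[X' [dX' XX']] [Y' [dY' YY']]]; apply: Mtdef_definable; apply: definable_and.
    by apply: (definable_comp _ dX'); exact: definable_fun_fst.
  by apply: (definable_comp _ dY'); exact: definable_fun_snd.
- move=> [X1 Y1] [X2 Y2]; have [X3 X3P] := dsup_dir X1 X2.
  have [Y3 Y3P] := dsup_dir Y1 Y2; exists (X3, Y3) => -[x y] [/= /X3P[? ?] /Y3P[? ?]].
  by split; split.
- by apply: definable_not; apply: (definable_comp _ dR); exact: definable_fun_fst.
- move=> [[X' [dX' XX']] [Y' [dY' YY']]] /=; apply: contrapT => noxy; apply: noXY.
  exists X', Y'; split=> // x y X'x Y'y; apply: contrapT => nR.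
  by apply: noxy; exists (x, y).
apply => /=; apply: XYR.
  apply: tX => Q dQ XQ; have [Y0] := dsup_inhabited Y.
  by have [] := Wxy (dsup_mk dQ XQ, Y0).
apply: tY => Q dQ YQ; have [X0] := dsup_inhabited X.
by have [] := Wxy (X0, dsup_mk dQ YQ).
Qed.

(** * Types over the model *)

Definition same_type (S : sort Ms) (s s' : S) := forall Q : S -> Prop, Mdef Q -> Q s ->
  Q s'.

Lemma same_type_iff (S : sort Ms) (s s' : S) (Q : S -> Prop) : same_type s s' ->
  Mdef Q -> Q s <-> Q s'.
Proof.
move=> e dQ; split; first exact: e.
by move=> Qs'; apply: contrapT => nQs; exact: (e _ (definable_not dQ) nQs).
Qed.

Lemma same_type_sym (S : sort Ms) (s s' : S) : same_type s s' -> same_type s' s.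
Proof. by move=> e Q dQ; have [] := same_type_iff e dQ. Qed.

Lemma same_type_trans (S : sort Ms) (s s' s'' : S) : same_type s s' ->
  same_type s' s'' -> same_type s s''.
Proof. by move=> e e' Q dQ /(e _ dQ); exact: e'. Qed.

Lemma same_type_fun (S S' : sort Ms) (f : S -> S') (s s' : S) :
  Mfun f -> same_type s s' -> same_type (f s) (f s').
Proof. by move=> df e Q dQ; exact: (e _ (definable_comp df dQ)). Qed.

(** Strong homogeneity, applied to the partial elementary map that fixes M and sends the coordinates
    of s to those of s'. *)
Lemma same_type_automorphism (S : sort Ms) (s s' : S) : same_type s s' ->
  exists f : Ms -> Ms, [/\ automorphism f, forall a, range j a -> f a = a &
    f \o sco s = sco s'].
Proof.
move=> e; pose V := (svar S + range j)%type; pose ev (t : S) : V -> Ms :=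
  assign (sco t) (@param _ _).
have evE (phi : form L V) : sat phi (ev s) <-> sat phi (ev s').
  by apply: (same_type_iff (Q := fun t => sat phi (ev t))) => //; exists phi.
pose A : set Ms := range j `|` range (sco s).
(* An element may be named by several variables, as a parameter or a repeated coordinate; one name
   is chosen, and equality of types makes the choice immaterial. *)
have /choice[pick pickP] : forall a : A, exists v : V, ev s v = val a.
  move=> a; have [ja|[v _ <-]] := set_valP a; last by exists (inl v).
  by exists (inr (SigSub (mem_set ja))).
have [phi|f fA fP] := homMs (f := fun a => ev s' (pick a)) (small_params (sco s)).
  have -> : @param _ A = ev s \o pick by apply/funext => a; rewrite /= pickP.
  by have := evE (frename pick phi); rewrite !sat_frename.
have fv v : f (ev s v) = ev s' v.
  have Av : A (ev s v).
    by case: v => [v|v]; [right; exists v|left; exact: set_valP].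
  rewrite (fP (SigSub (mem_set Av))).
  by apply: (evE (Feq (Tvar L (pick (SigSub (mem_set Av)))) (Tvar L v))).1;
    rewrite /= pickP.
exists f; split=> //.
  by move=> a ja; have := fv (inr (SigSub (mem_set ja))).
by apply/funext => v; exact: (fv (inl v)).
Qed.

Lemma Aut_invariant_same_type (H : set G) (x y : Gsort) : Aut_invariant co (range j) H ->
  same_type x y -> H x -> H y.
Proof.
move=> aH /same_type_automorphism[f [fA fj fxy]] Hx.
have : [set f \o x | x in co @` H] (co y) by exists (co x) => //; exists x.
by rewrite aH // => -[z Hz /(co_inj intG) <-].
Qed.

(** The set D of the opening comment; the set provided by the theorem is its [mul4]. *)
Definition type_quotients : set G := [set x | exists g h :
  Gsort, same_type g h /\ (g^-1 * h)%g = x].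

Lemma Mtdef_type_quotients : Mtdef (type_quotients : set Gsort).
Proof.
pose S := prod_sort Gsort Gsort.
have tE : Mtdef [set p : S | same_type p.1 p.2].
  rewrite (_ : [set p | _] = \bigcap_(Q in (fun Q : set Gsort => Mdef Q)) [set p :
    S | Q p.1 -> Q p.2]).
    apply: Mtdef_bigcap => Q dQ; apply: Mtdef_definable; apply: definable_imp.
      by apply: (definable_comp _ dQ); exact: definable_fun_fst.
    by apply: (definable_comp _ dQ); exact: definable_fun_snd.
  by apply/seteqP; split=> p H Q; exact: H.
have tW : Mtdef [set p :
  prod_sort S Gsort | same_type p.1.1 p.1.2 /\ (p.1.1^-1 * p.1.2)%g = p.2].
  apply: Mtdef_setI.
    by apply: (@Mtdef_pull (prod_sort S Gsort) S fst [set p :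
      S | same_type p.1 p.2]) => //; exact: definable_fun_fst.
  apply: Mtdef_definable; apply: (definable_comp2 (f := fun p :
    prod_sort S Gsort => (p.1.1^-1 * p.1.2)%g : Gsort)
    (g := snd) (Q := fun p : S => p.1 = p.2)).
  - apply: Mfun_mulg.
      by apply: Mfun_invg; exact: definable_fun_comp (@definable_fun_fst _ _ _ _ _)
        (@definable_fun_fst _ _ _ _ _).
    exact: definable_fun_comp (@definable_fun_snd _ _ _ _ _) (@definable_fun_fst _ _ _
      _ _).
  - exact: definable_fun_snd.
  - exact: definable_eq.
move: (Mtdef_proj tW); congr Mtdef; apply/seteqP; split=> x.
  by move=> [[g h] [? ?]]; exists g, h.
by move=> [g [h [? ?]]]; exists (g, h).
Qed.

(** Each Q of the list cuts B in two, and every nonempty cell of the final partition contains a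
    point of G(M) by elementarity. *)
Lemma finite_types (l : seq (set Gsort)) (B : set Gsort) :
  (forall Q, List.In Q l -> Mdef Q) -> Mdef B ->
  exists2 F : seq Gsort, forall f, List.In f F -> Mpoint f &
    forall g, B g -> exists2 f, List.In f F & B f /\ forall Q, List.In Q l -> Q f <-> Q g.
Proof.
elim: l B => [|Q l IHl] B dl dB.
  have [Bne|B0] := pselect (exists g, B g); last first.
    by exists [::] => // g Bg; exfalso; apply: B0; exists g.
  have [f Bf Mf] := Mpoint_exists dB Bne; exists [:: f]; first by move=> x [<-|].
  by move=> g _; exists f; [left|].
have dQ : Mdef Q by apply: dl; left.
have {}dl Q' : List.In Q' l -> Mdef Q' by move=> Q'l; apply: dl; right.
have [F FM FP] := IHl _ dl (definable_and dB dQ).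
have [F' FM' FP'] := IHl _ dl (definable_and dB (definable_not dQ)).
exists (F ++ F'); first by move=> f /List.in_app_iff[/FM|/FM'].
move=> g Bg; have [Qg|nQg] := pselect (Q g).
  have [f fF [[Bf Qf] fP]] := FP g (conj Bg Qg); exists f.
    by apply/List.in_app_iff; left.
  by split=> // Q' [<-|]; [split|exact: fP].
have [f fF [[Bf Qf] fP]] := FP' g (conj Bg nQg); exists f.
  by apply/List.in_app_iff; right.
by split=> // Q' [<-|]; [split=> [/Qf|/nQg]|exact: fP].
Qed.

(** By compactness there are finitely many M-definable sets such that g^-1 h is in V as soon as g
    and h belong to the same ones. Representatives in G(M) of the finitely many cells then give the
    translates. *)
Lemma type_quotients_generic (V : set Gsort) : Mdef V -> type_quotients `<=` V ->
  exists2 F : seq Gsort, forall f, List.In f F -> Mpoint f &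
    forall g, exists2 f, List.In f F & V (f^-1 * g)%g.
Proof.
move=> dV DV.
pose Idx := {l : seq (set Gsort) | forall Q, List.In Q l -> Mdef Q}.
pose S := prod_sort Gsort Gsort.
pose W (l : Idx) : set S := [set p | forall Q, List.In Q (sval l) -> Q p.1 <-> Q p.2].
suff [l Wl] : exists l, forall p, W l p -> V (p.1^-1 * p.2)%g.
  have [F FM FP] := finite_types (svalP l) (definable_True (range j) Gsort).
  exists F => // g; have [f fF [_ fP]] := FP g I.
  by exists f => //; exact: (Wl (f, g)).
apply: contrapT => nol.
have [|||||[g h] Wgh] := @compactness S Gsort 1%g _ W (fun p => ~ V (p.1.1^-1 * p.1.2)%g).
- have l0 : forall Q : set Gsort, List.In Q [::] -> Mdef Q by [].
  by constructor; exists [::].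
- move=> [l dl]; apply: Mtdef_definable; apply: definable_all => Q Ql;
  apply: definable_iff.
    by apply: (definable_comp _ (dl _ Ql)); exact: definable_fun_fst.
  by apply: (definable_comp _ (dl _ Ql)); exact: definable_fun_snd.
- move=> [l dl] [l' dl'].
  have dll Q : List.In Q (l ++ l') -> Mdef Q by move=> /List.in_app_iff[/dl|/dl'].
  exists (exist _ (l ++ l') dll) => p H.
  by split=> Q Ql; apply: H; apply/List.in_app_iff; [left|right].
- apply: definable_not; apply: (definable_comp _ dV); apply: Mfun_mulg.
    by apply: Mfun_invg; exact: definable_fun_comp (@definable_fun_fst _ _ _ _ _)
      (@definable_fun_fst _ _ _ _ _).
  exact: definable_fun_comp (@definable_fun_snd _ _ _ _ _) (@definable_fun_fst _ _ _ _ _).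
- move=> l; apply: contrapT => nop; apply: nol; exists l => p Wp.
  by apply: contrapT => nV; apply: nop; exists p.
apply; apply: DV; exists g, h; split=> // Q dQ.
have dl Q' : List.In Q' [:: Q] -> Mdef Q' by case=> [<-|].
by have /= [|? _] := Wgh (exist _ [:: Q] dl) Q; [left|].
Qed.

(* U is a coheir of tp(g/M), and a realizes U over representatives of the cosets
   of H that contain realizations of tp(g/M), hence is in the coset of one of them,
   r. As U is M-invariant, (r, a), (g, a) and (h, a) have the same type over M, so
   g^-1 a and h^-1 a are in H like r^-1 a. *)
Lemma type_quotients_sub (H : set G) : subgroup H -> bounded_index K H ->
  Aut_invariant co (range j) H -> type_quotients `<=` H.
Proof.
move=> [H1 HM HV] bH aH _ [g [h [egh <-]]].
(* The traces on G(M) of the sets in tp(g/M), nonempty by elementarity; an ultrafilter containing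
   them is a coheir. *)
pose F0 : set_system Gsort := [set B | exists2 Q : set Gsort, Mdef Q /\ Q g &
  Q `&` Mpoint (S := Gsort) `<=` B].
have F0P : ProperFilter F0.
  split.
    move=> [Q [dQ Qg] Q0]; have [x Qx Mx] := Mpoint_exists dQ (ex_intro _ g Qg).
    exact: (Q0 x).
  split.
  - by exists setT => //; split=> //; exact: definable_True.
  - move=> B B' [Q [dQ Qg] QB] [Q' [dQ' Qg'] QB']; exists (Q `&` Q').
      by split=> //; exact: definable_and.
    by move=> x [[Qx Q'x] Mx]; split; [exact: QB|exact: QB'].
  - by move=> B B' BB' [Q Qg QB]; exists Q => // x /QB/BB'.
have [U [Uultra F0U]] := ultraFilterLemma F0P.
(* The representative depends on the coset only, so there are no more of them than cosets and they
   form a small set; the default 1 serves cosets without a realization. *)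
pose rep (C : set G) : Gsort := if pselect (exists2 r : Gsort, same_type g r &
  translate r H = C) is left e
  then projT1 (cid2 e) else 1%g.
have repP (a : Gsort) : same_type g a ->
  same_type g (rep (translate a H)) /\ H ((rep (translate a H))^-1 * a)%g.
  move=> ega; rewrite /rep; case: pselect => [e|[]]; last by exists a.
  case: (cid2 e) => r egr /= rH; split=> //.
  have : translate r H a by rewrite rH; exists 1%g => //; rewrite mulg1.
  by move=> [x Hx <-]; rewrite mulKg.
pose Rep := rep @` range (fun g => translate g H).
pose A := (range j `|` range (sco ((g, h) : prod_sort Gsort Gsort))) `|`
  [set y | exists i : 'I_d, ((fun r : Gsort => co r i) @` Rep) y].
have smA : small K A.
  apply: small_setU; [exact: K_infinite|exact: small_params|].
  apply: small_bigcup; first exact: K_infinite.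
  move=> i; apply: small_le bH _; apply: card_le_trans (card_image_le _ _) _.
  exact: card_image_le.
have jA : range j `<=` A by move=> x jx; left; left.
have gA v : A (sco (g : Gsort) v) by left; right; exists (inl v).
have hA v : A (sco (h : Gsort) v) by left; right; exists (inr v).
have rA (a : Gsort) v : A (sco (rep (translate a H)) v).
  by right; exists v; exists (rep (translate a H)) => //; exists (translate a H) => //;
    exists a.
have [Q []//| |a aP] := saturation satMs (S := Gsort) (F :=
  [set Q | definable A Q /\ U Q]) smA.
  move=> l lF; apply: (@filter_ex _ U).
  elim: l lF => [|Q l IHl] lF; first exact: filterS filterT.
  have UQ : U Q by have [] := lF Q (or_introl erefl).
  have Ul := IHl (fun Q' Q'l => lF Q' (or_intror Q'l)).
  by apply: filterS (filterI UQ Ul) => x [Qx lx] Q' [<-|/lx].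
have aU Q : definable A Q -> Q a -> U Q.
  move=> dQ Qa; have [//|UQ] := in_ultra_setVsetC Q Uultra.
  by exfalso; apply: (aP (~` Q)) => //; split=> //; exact: definable_not.
have ega : same_type g a.
  move=> Q dQ Qg; apply: aP; split; first exact: definable_sub dQ.
  by apply: F0U; exists Q => // x [].
(* A set Q separating (r, a) from (r', a) would do so for U-almost every x in place of a, hence for
   some x in G(M), against the equality of the types of r and r' over M. *)
have inv (r r' : Gsort) : (forall v, A (sco r v)) -> (forall v, A (sco r' v)) ->
  same_type r r' ->
    same_type ((r, a) : prod_sort Gsort Gsort) (r', a).
  move=> Ar Ar' err Q dQ Qra; apply: contrapT => nQ.
  have dQA := definable_sub jA dQ.
  have U1 : U (fun x => Q (r, x)).
    apply: aU => //; apply: definable_comp2 dQA;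
      [exact: definable_fun_cst|exact: definable_fun_id].
  have U2 : U (fun x => ~ Q (r', x)).
    apply: aU => //; apply: definable_not; apply: definable_comp2 dQA;
      [exact: definable_fun_cst|exact: definable_fun_id].
  have UM : U (Mpoint (S := Gsort)).
    by apply: F0U; exists setT; [split=> //; exact: definable_True|move=> x []].
  have [x [[Qrx nQx] Mx]] := filter_ex (filterI (filterI U1 U2) UM).
  apply: nQx; apply: (err (fun y => Q (y, x))) => //.
  by apply: definable_comp2 dQ; [exact: definable_fun_id|exact: definable_fun_cst].
have dq : Mfun (fun p : prod_sort Gsort Gsort => p.1^-1 * p.2 : Gsort)%g.
  by apply: Mfun_mulg; [apply: Mfun_invg;
    exact: definable_fun_fst|exact: definable_fun_snd].
have [egr Hra] := repP a ega.
have Hga : H (g^-1 * a)%g.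
  apply: (Aut_invariant_same_type aH _ Hra).
  by apply: (same_type_fun dq (inv _ _ _ _ (same_type_sym egr))); [exact: rA|].
have Hha : H (h^-1 * a)%g.
  apply: (Aut_invariant_same_type aH _ Hra).
  by apply: (same_type_fun dq (inv _ _ _ _ (same_type_trans (same_type_sym egr) egh)));
    [exact: rA|].
have := HM _ _ Hga (HV _ Hha).
by rewrite invgM invgK mulgA mulgK.
Qed.

(** * Means *)

Section Mean.
Context (R : realType) (m : set G -> R).
Hypothesis mP : invariant_mean K co m.
Local Open Scope ring_scope.

Definition cMtdef (X : set Gsort) := closed (X : set G) /\ Mtdef X.

Lemma cMtdef_closed_tdef (X : set Gsort) : cMtdef X -> closed_tdef K co X.
Proof.
move=> [cX tX]; split=> //; exists (range j); first exact: small_M.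
exact: (@MtdefP Gsort X).2.
Qed.
Hint Resolve cMtdef_closed_tdef : core.

Lemma cMtdefI (X Y : set Gsort) : cMtdef X -> cMtdef Y -> cMtdef (X `&` Y).
Proof. by move=> [? ?] [? ?]; split; [exact: closedI|exact: Mtdef_setI]. Qed.

Lemma cMtdefU (X Y : set Gsort) : cMtdef X -> cMtdef Y -> cMtdef (X `|` Y).
Proof. by move=> [? ?] [? ?]; split; [exact: closedU|exact: Mtdef_setU]. Qed.

Lemma cMtdef0 : cMtdef set0.
Proof. by split; [exact: closed0|apply: Mtdef_definable; exact: definable_False]. Qed.

Lemma cMtdefT : cMtdef setT.
Proof. by split; [exact: closedT|apply: Mtdef_definable; exact: definable_True]. Qed.

Lemma cMtdef_translate (g : Gsort) (X : set Gsort) : Mpoint g -> cMtdef X ->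
  cMtdef (translate g X).
Proof. by move=> Mg [? ?]; split; [exact: closed_translate|exact: Mtdef_translate]. Qed.

Lemma cMtdef_closure (X : set Gsort) : Mtdef X -> cMtdef (closure X).
Proof. by move=> tX; split; [exact: closed_closure|exact: Mtdef_closure]. Qed.

Lemma cMtdef_mul (X Y : set Gsort) : cMtdef X -> cMtdef Y -> cMtdef (mul_set X Y).
Proof. by move=> [? ?] [? ?]; split; [exact: closed_mul_set|exact: Mtdef_mul_set]. Qed.

Lemma cMtdef_inv (X : set Gsort) : cMtdef X -> cMtdef (inv_set X).
Proof. by move=> [? ?]; split; [exact: closed_inv_set|exact: Mtdef_inv_set]. Qed.

Lemma cMtdef_inter (X : set Gsort) (C : seq Gsort) : cMtdef X ->
  (forall c, List.In c C -> Mpoint c) -> cMtdef (inter X C).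
Proof.
move=> gX; elim: C => [|c C IHC] CM.
  by rewrite (_ : inter X _ = setT); [exact: cMtdefT|apply/seteqP; split=> // x _ c []].
have -> : inter X (c :: C) = translate c X `&` inter X C.
  rewrite translateE; apply/seteqP; split=> [x H|x [Xx H] y [<-//|/H//]].
  by split=> [|y yC]; apply: H; [left|right].
apply: cMtdefI; first by apply: cMtdef_translate => //; apply: CM; left.
by apply: IHC => y yC; apply: CM; right.
Qed.

Definition translates (B : set Gsort) (F : seq Gsort) : set Gsort :=
  foldr (fun f U => translate f B `|` U) set0 F.

Lemma cMtdef_translates (B : set Gsort) (F : seq Gsort) : cMtdef B ->
  (forall f, List.In f F -> Mpoint f) -> cMtdef (translates B F).
Proof.
move=> gB; elim: F => [|f F IHF] FM; first exact: cMtdef0.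
apply: cMtdefU; first by apply: cMtdef_translate => //; apply: FM; left.
by apply: IHF => y yC; apply: FM; right.
Qed.

Lemma mean_translates_cap (B D : set Gsort) (F : seq Gsort) (s : R) : cMtdef B ->
  cMtdef D ->
  (forall f, List.In f F -> Mpoint f) ->
  (forall f, List.In f F -> m (D `&` translate f B) <= s) ->
  m (D `&` translates B F) <= (size F)%:R * s.
Proof.
move=> gB gD; elim: F => [|f F IHF] FM Fs.
  by rewrite /= setI0 (mean_set0 mP) mul0r.
have gU : cMtdef (translates B F) by apply: cMtdef_translates => // y yC; apply: FM;
  right.
have gT : cMtdef (translate f B) by apply: cMtdef_translate => //; apply: FM; left.
rewrite [translates _ _]/= setIUr (mean_setU mP); [|by apply: cMtdef_closed_tdef;
  apply: cMtdefI..].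
have H1 : 0 <= m ((D `&` translate f B) `&` (D `&` translates B F)).
  by apply: (mean_ge0 mP); apply: cMtdef_closed_tdef; do ![apply: cMtdefI => //].
have H2 : m (D `&` translate f B) <= s by apply: Fs; left.
have H3 : m (D `&` translates B F) <= (size F)%:R * s.
  by apply: IHF => y yC; [apply: FM|apply: Fs]; right.
rewrite [size (f :: F)]/= -natr1; lra.
Qed.

(** Finite subadditivity and invariance give 1 <= |F| m(B). *)
Lemma cover_wide (B : set Gsort) (F : seq Gsort) : cMtdef B ->
  (forall f, List.In f F -> Mpoint f) ->
  (forall g, exists2 f, List.In f F & B (f^-1 * g)%g) -> 0 < m B.
Proof.
move=> gB FM cov.
have := @mean_translates_cap B setT F (m B) gB cMtdefT FM.
rewrite (_ : setT `&` translates B F = setT).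
  rewrite (mean_setT mP) => /(_ _) H.
  have {H} : 1 <= (size F)%:R * m B.
    by apply: H => f fF; rewrite setTI (mean_translate mP) //; exact: cMtdef_closed_tdef.
  have : 0 <= m B by apply: (mean_ge0 mP); exact: cMtdef_closed_tdef.
  rewrite le_eqVlt => /orP[/eqP <-|//].
  by rewrite mulr0 ler10.
rewrite setTI; apply/seteqP; split=> // g _; have [f + Bf] := cov g.
elim: F {FM cov} => //= h F IHF [->|fF]; last by right; exact: IHF.
by left; exists (f^-1 * g)%g => //; rewrite mulVKg.
Qed.

(* Otherwise the union of the translates has mean at least 2 - 1/2. *)
Lemma mean_pigeonhole (B : set Gsort) (t : R) k (g : 'I_k -> Gsort) : cMtdef B ->
  t <= m B ->
  2 <= k%:R * t -> (forall i, Mpoint (g i)) ->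
  exists a b, a != b /\ (2 * k%:R * k%:R)^-1 <= m (translate (g a) B `&` translate (g
    b) B).
Proof.
move=> gB tB kt gM; apply: contrapT => nopair.
have k0 : 0 < k%:R :> R.
  by rewrite ltr0n lt0n; apply/eqP => k0; move: kt; rewrite k0 mul0r; lra.
(* Chosen with k k s = 1/2, which bounds the total loss from overlaps. *)
set s := (2 * k%:R * k%:R)^-1 in nopair *.
have s0 : 0 <= s by rewrite invr_ge0; do ![apply: mulr_ge0 => //].
have pair a b : a != b -> m (translate (g a) B `&` translate (g b) B) <= s.
  move=> ab; rewrite leNgt; apply/negP => /ltW H; apply: nopair; by exists a, b.
(* Each new translate adds at least t and overlaps the previous ones by at most k s. *)
have H (l : seq 'I_k) : uniq l ->
  (size l)%:R * t - (size l)%:R * k%:R * s <= m (translates B (map g l)).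
  elim: l => [_|i l IHl].
    by rewrite !mul0r subrr (mean_set0 mP).
  move=> /= /andP[il ul]; have {}IHl := IHl ul.
  have lM : forall f, List.In f (map g l) -> Mpoint f by move=> _ /List_In_map[a _ <-].
  have gU : cMtdef (translates B (map g l)) by exact: cMtdef_translates.
  have gT : cMtdef (translate (g i) B) by exact: cMtdef_translate.
  rewrite (mean_setU mP) ?(mean_translate mP); [|exact: cMtdef_closed_tdef..].
  have : m (translate (g i) B `&` translates B (map g l)) <= (size (map g l))%:R * s.
    apply: mean_translates_cap => // _ /List_In_map[a al <-]; apply: pair.
    apply: contraNneq il => ->.
    by elim: l al {ul IHl lM gU} => //= b l IHl [->|/IHl]; rewrite inE ?eqxx // => ->;
      rewrite orbT.
  have : (size l)%:R * s <= k%:R * s.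
    apply: ler_wpM2r => //; rewrite ler_nat -[leqRHS]card_ord -(card_uniqP ul).
    exact: max_card.
  rewrite size_map -natr1; lra.
have := H _ (enum_uniq 'I_k); rewrite size_enum_ord.
have -> : k%:R * k%:R * s = 2^-1 :> R.
  by rewrite /s; field; rewrite gt_eqF.
have : m (translates B (map g (enum 'I_k))) <= 1.
  apply: (mean_le1 mP); apply: cMtdef_closed_tdef; apply: cMtdef_translates => //.
  by move=> _ /List_In_map[a _ <-].
lra.
Qed.

(** From a lower bound t, an integer k with k t >= 2 leaves, by pigeonhole, two translates meeting
    in mean at least 1/(2 k^2), the lower bound for the next stage. The list of integers depends on
    t and not on C. *)
Lemma wide_large (P Q : set Gsort) : cMtdef P -> Mdef Q -> P `<=` Q ->
  forall n (t : R), 0 < t -> exists2 ks, size ks = n /\ all (ltn 0) ks &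
    forall C : seq Gsort, (forall c, List.In c C -> Mpoint c) -> t <= m (inter P C) ->
      large (Q : set G) ks C.
Proof.
move=> gP dQ PQ; elim=> [|n IHn] t t0.
  exists [::] => // C CM tC; apply: contrapT => noC.
  suff e : inter P C = set0 by move: tC; rewrite e (mean_set0 mP); lra.
  apply/seteqP; split=> // x Hx; apply: noC; exists x => c /Hx; exact: PQ.
have [k kt] : exists k : nat, 2 <= k%:R * t.
  exists (Num.truncn (2 / t)).+1.
  by rewrite -ler_pdivrMr // ltW // truncnS_gt.
have k0 : 0 < k%:R :> R.
  by rewrite ltr0n lt0n; apply/eqP => k0; move: kt; rewrite k0 mul0r; lra.
have t'0 : 0 < (2 * k%:R * k%:R)^-1 :> R by rewrite invr_gt0; do ![apply: mulr_gt0 => //].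
have [ks [ksn kspos] ksP] := IHn _ t'0.
exists (k :: ks) => /=; first by rewrite ksn kspos -(ltr0n R) k0.
move=> C CM tC.
suff H : forall g : power_sort k Gsort, exists a b : 'I_k, a != b /\
    large (Q : set G) ks ([seq (g a * c)%g | c <- C] ++ [seq (g b * c)%g | c <- C]) by [].
(* Largeness being definable over M, the translating elements may be taken in G(M), where
   intersections stay M-type-definable and the induction hypothesis applies. *)
apply: Mpoint_forall.
  apply: Mdef_ex_fin => a; apply: Mdef_ex_fin => b; apply: definable_and;
    first exact: Mdef_cst.
  pose us (a : 'I_k) : seq (power_sort k Gsort -> Gsort) := [seq (fun g => g a * c :
    Gsort)%g | c <- C].
  have dus e u : List.In u (us e) -> Mfun u.
    move=> /List_In_map[c cC <-]; apply: Mfun_mulg; first exact: definable_fun_coord.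
    exact: definable_fun_cst (CM _ cC).
  have := @Mdef_large Q _ ks (us a ++ us b) dQ.
  have E g : [seq u g | u <- us a ++ us b] =
    [seq (g a * c)%g | c <- C] ++ [seq (g b * c)%g | c <- C] by rewrite map_cat
      -!map_comp.
  move=> H; apply: (definable_ext _ (H _)) => [g|u]; first by rewrite E.
  by move=> /List.in_app_iff[]; exact: dus.
move=> g Mg; have gM i : Mpoint (g i : Gsort) by move=> v; exact: (Mg (i, v)).
have gB : cMtdef (inter P C) by exact: cMtdef_inter.
have [a [b [ab mab]]] := mean_pigeonhole gB tC kt gM.
exists a, b; split=> //; apply: ksP; last by rewrite interU !inter_translate.
by move=> _ /List.in_app_iff[] /List_In_map[c cC <-]; apply: MpointM => //; exact: CM.
Qed.

(** * Closed sets almost fixed by a translation and the generic stabilizer *)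

Definition almost_fixed (e : R) (Y : set Gsort) (x : Gsort) :=
  m Y - e <= m (translate x Y `&` Y).

Lemma translateM (x y : G) (Y : set G) :
  translate (x * y)%g Y = translate x (translate y Y).
Proof.
apply/seteqP; split=> [_ [z Yz <-]|_ [_ [z Yz <-] <-]]; last by exists z => //;
  rewrite mulgA.
by exists (y * z)%g; [exists z|rewrite mulgA].
Qed.

Lemma translateI (x : G) (Y Y' : set G) :
  translate x (Y `&` Y') = translate x Y `&` translate x Y'.
Proof. by rewrite !translateE. Qed.

(** The sets xyY [&] xY and xY [&] Y lie in xY, of mean m(Y), and miss at most e' and e of it. Their
    intersection lies in xyY [&] Y. *)
Lemma almost_fixed_mul (e e' : R) (Y : set Gsort) (x y : Gsort) : cMtdef Y ->
  Mpoint x -> Mpoint y ->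
  almost_fixed e Y x -> almost_fixed e' Y y -> almost_fixed (e + e') Y (x * y)%g.
Proof.
move=> gY Mx My; rewrite /almost_fixed => xY yY.
have gx : cMtdef (translate x Y) by exact: cMtdef_translate.
have gy : cMtdef (translate y Y) by exact: cMtdef_translate.
have gxy : cMtdef (translate (x * y)%g Y) by apply: cMtdef_translate => //;
  exact: MpointM.
have gxy' : cMtdef (translate (x * y)%g Y `&` translate x Y) by exact: cMtdefI.
have gx' : cMtdef (translate x Y `&` Y) by exact: cMtdefI.
have E : m (translate (x * y)%g Y `&` translate x Y) = m (translate y Y `&` Y).
  by rewrite translateM -translateI (mean_translate mP) //; apply: cMtdef_closed_tdef;
    exact: cMtdefI.
have H1 := mean_setU mP (cMtdef_closed_tdef gxy') (cMtdef_closed_tdef gx').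
have H2 : m (translate (x * y)%g Y `&` translate x Y `|` translate x Y `&` Y) <= m Y.
  rewrite -(mean_translate mP x (cMtdef_closed_tdef gY)).
  apply: (mean_mono mP); try (apply: cMtdef_closed_tdef; by [|exact: cMtdefU]).
  by move=> z [[_]|[]].
have H3 : m (translate (x * y)%g Y `&` translate x Y `&` (translate x Y `&` Y)) <=
    m (translate (x * y)%g Y `&` Y).
  apply: (mean_mono mP); try (apply: cMtdef_closed_tdef; exact: cMtdefI).
  by move=> z [[? _] [_ ?]].
rewrite E in H1; lra.
Qed.

Lemma almost_fixed_inv (e : R) (Y : set Gsort) (x : Gsort) : cMtdef Y -> Mpoint x ->
  almost_fixed e Y x -> almost_fixed e Y (x^-1)%g.
Proof.
move=> gY Mx; rewrite /almost_fixed => xY.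
have gx : cMtdef (translate x^-1%g Y) by apply: cMtdef_translate => //; exact: MpointV.
rewrite -(mean_translate mP x (Y := translate x^-1%g Y `&` Y)); last first.
  by apply: cMtdef_closed_tdef; exact: cMtdefI.
rewrite translateI -translateM mulgV setIC.
by rewrite (_ : translate 1%g Y = Y) // translateE; apply/seteqP; split=> z /=;
  rewrite invg1 mul1g.
Qed.

Lemma almost_fixed_setpow (e : R) (Y X : set Gsort) n (w : Gsort) : cMtdef Y ->
  (forall x, X x -> Mpoint x /\ almost_fixed e Y x) -> setpow n X w ->
    Mpoint w /\ almost_fixed (n%:R * e) Y w.
Proof.
move=> gY XP; elim: n w => [|n IHn] w.
  move=> /= ->; split; first exact: Mpoint1.
  rewrite /almost_fixed mul0r subr0 (_ : translate 1%g Y = Y) ?setIid //.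
  by rewrite translateE; apply/seteqP; split=> z /=; rewrite invg1 mul1g.
move=> [x /XP[Mx xY] [y /IHn[My yY] <-]]; split; first exact: MpointM.
by rewrite -natr1 mulrDl mul1r addrC; exact: almost_fixed_mul.
Qed.

(* Eight factors, each moving at most 1/16 of the mean, move at most one half. *)
Lemma find_stable (P Q : set Gsort) ks (C : seq Gsort) : cMtdef P -> 0 < m P ->
  Mdef Q -> P `<=` Q ->
  (forall c, List.In c C -> Mpoint c) -> List.In 1%g C -> large (Q : set G) ks C ->
  all (ltn 0) ks -> (15 / 16) ^+ size ks < m P ->
  exists k (ks' : seq nat) (C' : seq Gsort), [/\ forall c, List.In c C' ->
    Mpoint c, List.In 1%g C',
    large (Q : set G) (k :: ks') C', 0 < m (closure (mul_set (inter Q C') Q)) &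
    forall g : Gsort, Mpoint g -> large (Q :
      set G) ks' (C' ++ [seq (g * c)%g | c <- C']) ->
      m (closure (mul_set (inter Q C') Q)) * (15 / 16) <=
      m (closure (mul_set (inter Q (C' ++ [seq (g * c)%g | c <- C'])) Q))].
Proof.
move=> gP P0 dQ PQ.
pose Y (C : seq Gsort) := closure (mul_set (inter Q C) Q).
have gY C0 : (forall c, List.In c C0 -> Mpoint c) -> cMtdef (Y C0).
  by move=> CM; apply: cMtdef_closure; apply: Mtdef_definable;
    apply: Mdef_mul_set => //; exact: Mdef_inter.
(* The set contains a translate bP with b in G(M), whence a lower bound independent of C. *)
have mY (C0 : seq Gsort) : (forall c, List.In c C0 -> Mpoint c) -> inter (Q :
  set G) C0 !=set0 ->
    m P <= m (Y C0).
  move=> CM /(Mpoint_exists (Mdef_inter dQ CM))[b Qb Mb].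
  rewrite -(mean_translate mP b (cMtdef_closed_tdef gP)).
  apply: (mean_mono mP); first by apply: cMtdef_closed_tdef; exact: cMtdef_translate.
    by apply: cMtdef_closed_tdef; exact: gY.
  by move=> _ [x Px <-]; apply: subset_closure; exists b => //; exists x => //; exact: PQ.
move=> CM C1 lC kspos small.
(* The invariant of the induction; with ks empty it contradicts the lower bound m(P). *)
have : m (Y C) * (15 / 16) ^+ size ks < m P.
  apply: le_lt_trans small; rewrite ler_piMl // ?exprn_ge0 //; first lra.
  by apply: (mean_le1 mP); apply: cMtdef_closed_tdef; exact: gY.
elim: ks C CM C1 lC kspos {small} => [|k ks IH] C CM C1 lC kspos.
  by rewrite expr0 mulr1 ltNge => /negP; case; exact: mY.
have YC0 : 0 < m (Y C) by apply: (lt_le_trans P0); apply: mY => //;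
  exact: large_nonempty lC.
move=> mYs; apply: contrapT => nostab.
have [g [Mg lg mg]] : exists g : Gsort, [/\ Mpoint g, large (Q :
  set G) ks (C ++ [seq (g * c)%g | c <- C]) &
   m (Y (C ++ [seq (g * c)%g | c <- C])) < m (Y C) * (15 / 16)].
  apply: contrapT => nog; apply: nostab; exists k, ks, C; split=> // g Mg lg.
  rewrite leNgt; apply/negP => H; apply: nog; by exists g.
(* An unstable C is replaced by its union with gC: one integer of ks is used up and the mean drops
   by the factor 15/16. *)
apply: nostab; apply: (IH (C ++ [seq (g * c)%g | c <- C])) => //.
- by move=> c /List.in_app_iff[/CM//|/List_In_map[c' /CM Mc' <-]]; exact: MpointM.
- by apply/List.in_app_iff; left.
- by have /andP[] := kspos.
- apply: le_lt_trans mYs; rewrite exprS mulrA ler_wpM2r ?exprn_ge0 //; first lra.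
  exact: ltW.
Qed.

Definition closed_quotients (Q : set Gsort) : set Gsort :=
  mul_set (closure (mul_set Q Q)) (inv_set (closure (mul_set Q Q))).

Lemma cMtdef_closed_quotients (Q : set Gsort) : Mdef Q -> cMtdef (closed_quotients Q).
Proof.
move=> dQ; have gc : cMtdef (closure (mul_set Q Q)).
  by apply: cMtdef_closure; apply: Mtdef_definable; exact: Mdef_mul_set.
by apply: cMtdef_mul => //; exact: cMtdef_inv.
Qed.

(** Bernoulli's inequality in the form (15/16)^n (1 + n/16) <= 1, for n > 16/t. *)
Lemma exp_small (t : R) : 0 < t -> exists n, (15 / 16) ^+ n < t :> R.
Proof.
move=> t0; have bern n : (15 / 16) ^+ n * (1 + n%:R / 16) <= 1 :> R.
  elim: n => [|n IHn]; first by rewrite expr0 mul0r addr0 mulr1.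
  apply: le_trans IHn; rewrite exprSr -mulrA ler_wpM2l ?exprn_ge0 //; first lra.
  have : 0 <= n%:R :> R by []; rewrite -natr1; lra.
pose n := (Num.truncn (16 / t)).+1; exists n.
have nt : 16 / t < n%:R by rewrite /n truncnS_gt.
rewrite -(ltr_pM2r (x := 1 + n%:R / 16)); last first.
  have : 0 <= n%:R :> R by []; lra.
apply: le_lt_trans (bern n) _; rewrite mulrDr mulr1 mulrA.
move: nt; rewrite ltr_pdivrMr // [n%:R * t]mulrC => nt; lra.
Qed.

(** X is the symmetrized set of the g for which the union of C and gC is still large. Its genericity
    is the stage k of the largeness of C; the bound on its eighth power is stability of the mean,
    available on G(M) and transferred to G by definability. *)
Lemma generic_stabilizer (P Q : set Gsort) : cMtdef P -> 0 < m P -> Mdef Q -> P `<=` Q ->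
  exists X : set Gsort, [/\ Mdef X, X 1%g, forall x, X x -> X x^-1%g,
    exists F : seq Gsort, (forall f, List.In f F -> Mpoint f) /\
      forall g, exists2 f, List.In f F & X (f^-1 * g)%g &
    setpow 8 (closure X) `<=` closed_quotients Q].
Proof.
move=> gP P0 dQ PQ; have [n nP] := exp_small P0.
have [ks [ksn kspos] ksP] := wide_large gP dQ PQ n P0.
have [|||//||k [ks' [C [CM C1 lC Y0 stab]]]] := @find_stable P Q ks [:: 1%g] gP P0 dQ PQ.
- by move=> c [<-|//]; exact: Mpoint1.
- by left.
- apply: ksP => [c [<-|//]|]; first exact: Mpoint1.
  rewrite (_ : inter P [:: 1%g] = P) //; apply/seteqP; split=> x.
    by move=> /(_ 1%g (or_introl erefl)); rewrite invg1 mul1g.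
  by move=> Px c [<-|//]; rewrite invg1 mul1g.
- by rewrite ksn.
pose X0 : set Gsort := fun g => large (Q : set G) ks' (C ++ [seq (g * c)%g | c <- C]).
have dX0 : Mdef X0.
  pose us : seq (Gsort -> Gsort) := [seq (fun=> c) | c <- C] ++ [seq (fun g => g * c :
    Gsort)%g | c <- C].
  have dus u : List.In u us -> Mfun u.
    move=> /List.in_app_iff[] /List_In_map[c /CM Mc <-]; first exact: definable_fun_cst.
    by apply: Mfun_mulg; [exact: definable_fun_id|exact: definable_fun_cst].
  have E g : [seq u g | u <- us] = C ++ [seq (g * c)%g | c <- C].
    by rewrite map_cat -!map_comp map_id.
  by apply: definable_ext (@Mdef_large Q _ ks' us dQ dus) => g; rewrite E.
pose X : set Gsort := fun g => X0 g \/ X0 g^-1%g.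
have dX : Mdef X.
  by apply: definable_or => //; apply: (definable_comp _ dX0); apply: Mfun_invg;
    exact: definable_fun_id.
have XV x : X x -> X x^-1%g by rewrite /X invgK => -[]; [right|left].
exists X; split=> //.
  (* Among k copies of 1, the two returned give the union of C with itself. *)
  have [a [b [_ lab]]] := large_return (fun=> 1%g) lC.
  by left; move: lab; rewrite invg1 mul1g.
  have [F [FM FX]] : exists F : seq Gsort, (forall f, List.In f F -> Mpoint f) /\
      forall g : Gsort, exists2 f, List.In f F & (X0 (f^-1 * g) \/ X0 (g^-1 * f))%g.
    by apply: (@generic_cover X0 k) => // g; exact: large_return.
  exists F; split=> // g; have [f fF H] := FX g; exists f => //.
  by rewrite /X invgM invgK.
pose Y : set Gsort := closure (mul_set (inter Q C) Q).
have gY : cMtdef Y by apply: cMtdef_closure; apply: Mtdef_definable;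
  apply: Mdef_mul_set => //; exact: Mdef_inter.
(* The stable set attached to the union of C and xC is contained in xY [&] Y. *)
have X0Y x : Mpoint x -> X0 x -> almost_fixed (m Y / 16) Y x.
  move=> Mx X0x; have := stab x Mx X0x; rewrite /almost_fixed => H.
  have gY' : cMtdef (closure (mul_set (inter Q (C ++ [seq (x * c)%g | c <- C])) Q)).
    apply: cMtdef_closure; apply: Mtdef_definable; apply: Mdef_mul_set => //;
      apply: Mdef_inter => //.
    by move=> c /List.in_app_iff[/CM//|/List_In_map[c' /CM Mc' <-]]; exact: MpointM.
  have : m (closure (mul_set (inter Q (C ++ [seq (x * c)%g | c <- C])) Q)) <=
      m (translate x Y `&` Y).
    apply: (mean_mono mP); first exact: cMtdef_closed_tdef.
      by apply: cMtdef_closed_tdef; apply: cMtdefI => //; exact: cMtdef_translate.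
    rewrite interU inter_translate => z H'; split.
      rewrite /Y closure_translate; apply: closureS H' => _ [a [_ [a' Qa' <-]] [b Qb <-]].
      by exists (a' * b)%g; [exact: mul_setI|rewrite mulgA].
    by apply: closureS H'; apply: mul_setS => // a [].
  move: H; rewrite -/Y; lra.
have XY x : (X `&` Mpoint (S := Gsort)) x -> Mpoint x /\ almost_fixed (m Y / 16) Y x.
  move=> [X0x Mx]; split=> //; case: X0x => X0x; first exact: X0Y.
  rewrite -[x]invgK; apply: almost_fixed_inv => //; first exact: MpointV.
  by apply: X0Y => //; exact: MpointV.
have pwZ : setpow 8 X `<=` closed_quotients Q.
  (* The target is only type-definable, so the transfer is made for each of its M-definable
     supersets A. *)
  move=> w Xw; apply: (cMtdef_closed_quotients dQ).2 => A dA ZA.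
  apply: (setpow_transfer dX dA _ Xw) => {Xw}w /(almost_fixed_setpow gY XY)[Mw];
    rewrite /almost_fixed => H.
  (* At most 8/16 of the mean is lost, so wY meets Y, and w is a quotient of two elements of Y; Y
     lies in cl(QQ) because 1 is in C. *)
  apply: ZA; have [z [[y Yy <-] Yz]] : translate w Y `&` Y !=set0.
    apply: contrapT => /nonemptyPn e; move: H; rewrite e (mean_set0 mP);
      rewrite -/Y in Y0; lra.
  have YQ : Y `<=` closure (mul_set Q Q).
    apply: closureS; apply: mul_setS => // a /(_ 1%g C1).
    by rewrite invg1 mul1g.
  exists (w * y)%g; first exact: YQ.
  by exists y^-1%g; [exists y => //; exact: YQ|rewrite mulgK].
have closure_setpow n' : setpow n' (closure X) `<=` closure (setpow n' X).
  elim: n' => [|n' IHn']; first exact: subset_closure.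
  by move=> z /(mul_setS (fun _ H => H) IHn'); exact: closure_mul.
move=> z /closure_setpow H; rewrite ((closure_id _).1 (cMtdef_closed_quotients dQ).1).
exact: closureS H.
Qed.

(** * The type-definable subgroup *)

(** The closures of the M-definable supersets of A intersect in the closure of A, which is A;
    compactness does the rest. *)
Lemma closure_sep (A : set Gsort) (V : set Gsort) : cMtdef A -> Mdef V ->
  (forall a b, A a -> A b -> V (a * b^-1)%g) ->
  exists Q : set Gsort, [/\ Mdef Q, A `<=` Q &
    forall a b, closure Q a -> closure Q b -> V (a * b^-1)%g].
Proof.
move=> [cA tA] dV AV; apply: contrapT => noQ.
pose W (Q : dsup A) : set (prod_sort Gsort Gsort) :=
  [set q | closure (sval Q) q.1 /\ closure (sval Q) q.2].
have [|||||[a b] Wab] := @compactness (prod_sort Gsort Gsort) Gsort 1%g _ W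
  (fun p => ~ V (p.1.1 * p.1.2^-1)%g).
- exact: dsup_inhabited.
- move=> [Q [dQ AQ]]; apply: Mtdef_setI.
    by apply: (@Mtdef_pull (prod_sort Gsort Gsort) Gsort fst (closure Q));
      [exact: definable_fun_fst|apply: Mtdef_closure; exact: Mtdef_definable].
  by apply: (@Mtdef_pull (prod_sort Gsort Gsort) Gsort snd (closure Q));
    [exact: definable_fun_snd|apply: Mtdef_closure; exact: Mtdef_definable].
- move=> Q Q'; have [Q'' QQ] := dsup_dir Q Q'; exists Q'' => -[x y] [/= Hx Hy].
  have c1 := closureS (subset_trans QQ (@subIsetl _ _ _)).
  have c2 := closureS (subset_trans QQ (@subIsetr _ _ _)).
  by split; split; [exact: c1|exact: c1|exact: c2|exact: c2].
- apply: definable_not; apply: (definable_comp _ dV); apply: Mfun_mulg.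
    exact: definable_fun_comp (@definable_fun_fst _ _ _ _ _) (@definable_fun_fst _ _ _
      _ _).
  by apply: Mfun_invg; exact: definable_fun_comp (@definable_fun_snd _ _ _ _ _)
    (@definable_fun_fst _ _ _ _ _).
- move=> [Q [dQ AQ]] /=; apply: contrapT => noab; apply: noQ; exists Q;
  split=> // a b Qa Qb.
  by apply: contrapT => nV; apply: noab; exists (a, b).
have cl x : (forall Q : dsup A, closure (sval Q) x) -> A x.
  move=> H; rewrite ((closure_id _).1 cA); apply: closure_Mtdef => // Q dQ AQ.
  exact: (H (dsup_mk dQ AQ)).
by apply; apply: AV; apply: cl => Q; have [] := Wab Q.
Qed.

(** PPP^-1P^-1 is (PP)(PP)^-1 with PP closed, so [closure_sep] enlarges PP to a definable set; a
    second separation finds Q with QQ inside it. *)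
Lemma mul4_quotient_sep (P V : set Gsort) : cMtdef P -> Mdef V -> mul4 P `<=` V ->
  exists Q : set Gsort, [/\ Mdef Q, P `<=` Q & closed_quotients Q `<=` V].
Proof.
move=> gP dV PV.
have gPP : cMtdef (mul_set P P) by exact: cMtdef_mul.
have [|Q [dQ PPQ QV]] := closure_sep gPP dV.
  move=> _ _ [a Pa [b Pb <-]] [c Pc [e Pe <-]]; apply: PV; rewrite invgM mulgA.
  by apply: mul_setI; [apply: mul_setI; [exact: mul_setI|exists e]|exists c].
have [||X [Y [dX dY PX PY XYQ]]] := @Mtdef_sep2 P P (fun p => Q (p.1 * p.2)%g) gP.2 gP.2.
- by apply: (definable_comp _ dQ); apply: Mfun_mulg;
  [exact: definable_fun_fst|exact: definable_fun_snd].
- by move=> x y Px Py; apply: PPQ; exact: mul_setI.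
exists (X `&` Y); split; first exact: definable_and.
  by move=> x Px; split; [exact: PX|exact: PY].
have sub : closure (mul_set (X `&` Y) (X `&` Y)) `<=` closure Q.
  by apply: closureS => _ [x [Xx _] [y [_ Yy] <-]]; exact: XYQ.
by move=> _ [a /sub Qa [_ [b /sub Qb <-] <-]]; exact: QV.
Qed.

(** P' is cl(X) for a generic stabilizer X. Quotients of elements of cl(X)^4 are in cl(X)^8, hence
    in V, and separation provides a definable V' around cl(X)^4 with the same property. *)
Lemma shrink (P V : set Gsort) : cMtdef P -> 0 < m P -> Mdef V -> mul4 P `<=` V ->
  exists P' V' : set Gsort, [/\ cMtdef P', 0 < m P', Mdef V', mul4 P' `<=` V' &
    (forall a b, V' a -> V' b -> V (a^-1 * b)%g) /\
    exists F : seq Gsort, forall g, exists2 f, List.In f F & V' (f^-1 * g)%g].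
Proof.
move=> gP P0 dV PV; have [Q [dQ PQ ZV]] := mul4_quotient_sep gP dV PV.
have [X [dX X1 XV [F [FM FX]] XZ]] := generic_stabilizer gP P0 dQ PQ.
have gX : cMtdef (closure X) by apply: cMtdef_closure; exact: Mtdef_definable.
have XcV x : closure X x -> closure X x^-1%g.
  move=> Xx; have /closure_inv : inv_set (closure X) x^-1%g by exists x.
  by apply: closureS => _ [y /XV ? <-].
have gq : cMtdef (mul4 (closure X)) by do ![apply: cMtdef_mul => // | exact: cMtdef_inv].
have [||V1 [V2 [d1 d2 s1 s2 V12]]] :=
  @Mtdef_sep2 _ _ (fun p => V (p.1^-1 * p.2)%g) gq.2 gq.2.
- apply: (definable_comp _ dV); apply: Mfun_mulg; last exact: definable_fun_snd.
  by apply: Mfun_invg; exact: definable_fun_fst.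
- by move=> a b qa qb; apply/ZV/XZ; exact: mul4_quotient.
exists (closure X), (V1 `&` V2); split=> //.
- apply: (cover_wide gX FM) => g; have [f fF Xf] := FX g; exists f => //.
  exact: subset_closure.
- exact: definable_and.
- by move=> z qz; split; [exact: s1|exact: s2].
split=> [a b [Va _] [_ Vb]|]; first exact: V12.
exists F => g; have [f fF Xf] := FX g; exists f => //.
suff : mul4 (closure X) (f^-1 * g)%g by move=> qz; split; [exact: s1|exact: s2].
have c := @subset_closure _ (X : set G).
have V1X : inv_set (closure X : set G) 1%g by exists 1%g; [exact: c|exact: invg1].
(* An element of X is padded with 1 to become a product of four factors. *)
have -> : (f^-1 * g = f^-1 * g * 1 * 1 * 1)%g by rewrite !mulg1.
by do 2![apply: mul_setI => //]; apply: mul_setI; exact: c.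
Qed.

Lemma shrink_sequence (P V : set Gsort) : cMtdef P -> 0 < m P -> Mdef V ->
  mul4 P `<=` V ->
  exists W : nat -> set Gsort, [/\ W 0%N = V, forall n, Mdef (W n),
    forall n, (W n : set G) !=set0,
    forall n (a b : G), W n.+1 a -> W n.+1 b -> W n (a^-1 * b)%g &
    forall n, exists F : seq Gsort, forall g, exists2 f, List.In f F &
      W n.+1 (f^-1 * g)%g].
Proof.
move=> gP P0 dV PV.
pose state := {PV : set Gsort * set Gsort | [/\ cMtdef PV.1, 0 < m PV.1, Mdef PV.2 &
  mul4 PV.1 `<=` PV.2]}.
pose next (s s' : state) := (forall a b : G, (sval s').2 a -> (sval s').2 b ->
  (sval s).2 (a^-1 * b)%g) /\
    exists F : seq Gsort, forall g, exists2 f, List.In f F & (sval s').2 (f^-1 * g)%g.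
have /choice[nxt nxtP] : forall s : state, exists s', next s s'.
  move=> [[P1 V1] [gP1 P10 dV1 PV1]].
  have [P' [V' [gP' P'0 dV' PV' H]]] := shrink gP1 P10 dV1 PV1.
  by exists (exist _ (P', V') (And4 gP' P'0 dV' PV')).
pose s0 : state := exist _ (P, V) (And4 gP P0 dV PV).
exists (fun n => (sval (iter n nxt s0)).2); split=> // n.
- by have [] := svalP (iter n nxt s0).
- have [gPn Pn _ Vn] := svalP (iter n nxt s0).
  have [x Px] : ((sval (iter n nxt s0)).1 : set G) !=set0.
    apply: contrapT => /nonemptyPn e; move: Pn; rewrite e (mean_set0 mP); lra.
  exists (x * x * x^-1 * x^-1)%g; apply: Vn.
  by do 3?[apply: mul_setI]; rewrite //; exists x.
- by have [H _] := nxtP (iter n nxt s0).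
- by have [_ H] := nxtP (iter n nxt s0).
Qed.

(** * The component G00 inside fourth powers *)

(** The intersection H of the [W n] is a subgroup because quotients from [W n.+1] fall in [W n]. By
    genericity a coset of H is coded by a function from nat to nat, and such functions embed in the
    sets of formulas, so the index is bounded. *)
Lemma G00_sub (G00 : set G) (P V : set Gsort) : is_G00 K co (range j) G00 ->
  cMtdef P -> 0 < m P -> Mdef V -> mul4 P `<=` V -> G00 `<=` V.
Proof.
move=> [_ G00min] gP P0 dV PV.
have [W [W0 dW Wne Wdiv /choice[F FP]]] := shrink_sequence gP P0 dV PV.
pose H : set Gsort := \bigcap_n W n.
suff : G00 `<=` H by move=> GH x /GH; move=> /(_ 0%N I); rewrite W0.
have H1 : H 1%g by move=> n _; have [x Wx] := Wne n.+1; rewrite -(mulVg x); exact: Wdiv.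
have HV x y : H x -> H y -> H (x^-1 * y)%g.
  by move=> Hx Hy n _; apply: Wdiv; [exact: Hx|exact: Hy].
apply: G00min; split.
- split=> // [x y Hx Hy|x Hx]; last by rewrite -[(x^-1)%g]mulg1; exact: HV.
  rewrite -[x]invgK; apply: (HV) => //; rewrite -[(x^-1)%g]mulg1; exact: HV.
- apply: small_types; apply/card_le_relP.
  (* A coset is determined by the indices of the translates covering it. *)
  pose code (u : nat -> nat) : set (form L (nat + M)) :=
    [set phi | exists n, phi = Feq (Tvar L (inl n)) (Tvar L (inl (u n)))].
  have code_inj u v : code u = code v -> u = v.
    move=> /seteqP[uv _]; apply/funext => n.
    by have [n' [-> ->]] :
      code v (Feq (Tvar L (inl n)) (Tvar L (inl (u n)))) by apply: uv; exists n.
  have /choice[ix ixP] : forall g : Gsort, exists u : nat -> nat, forall n,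
      W n.+1 ((nth (1%g : G) (F n) (u n))^-1 * g)%g.
    move=> g.
    have /choice[u uP] n : exists i, W n.+1 ((nth (1%g : G) (F n) i)^-1 * g)%g.
      have [f + Wf] := FP n g; elim: (F n) => //= f' l IHl [->|/IHl[i]];
        first by exists 0%N.
      by exists i.+1.
    by exists u.
  exists (fun A X => exists2 g : G, translate g H = A & X = code (ix g)); split.
    by move=> _ [g _ <-]; exists (code (ix g)) => //; exists g.
  move=> _ _ _ _ _ [g <- ->] [h <- /code_inj e].
  (* Equal indices put x and y in the same translate of each [W n.+1], so x^-1 y is in every
     [W n]. *)
  suff E x y : ix x = ix y -> translate x H `<=` translate y H.
    by apply/seteqP; split; apply: E.
  move=> exy _ [z Hz <-]; exists (y^-1 * (x * z))%g; last by rewrite mulVKg.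
  rewrite mulgA -[(y^-1 * x)%g]invgK; apply: HV => // n _.
  rewrite invgM invgK; have := Wdiv n _ _ (ixP x n) (ixP y n).
  by rewrite exy invgM invgK -mulgA mulVKg.
- apply: (@MtdefP Gsort H).2; apply: Mtdef_bigcap => n _; exact: Mtdef_definable.
Qed.

Lemma G00_sub_mul4 (G00 : set G) (P : set Gsort) : is_G00 K co (range j) G00 ->
  cMtdef P -> 0 < m P -> G00 `<=` mul4 P.
Proof.
move=> hG00 gP P0 x Gx.
have [_ tq] : cMtdef (mul4 P) by do ![apply: cMtdef_mul => // | exact: cMtdef_inv].
by apply: tq => V dV PV; exact: (G00_sub hG00 gP P0 dV PV).
Qed.

(** Every M-definable V containing D is generic, so cl(V) is wide and cl(V)^4 contains G00.
    Compactness, applied to the four factors at once, lets V shrink to D. *)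
Lemma G00_sub_mul4_closure (G00 : set G) : is_G00 K co (range j) G00 ->
  G00 `<=` mul4 (closure type_quotients).
Proof.
move=> hG00 x Gx.
have GV (V : set Gsort) : Mdef V -> type_quotients `<=` V -> mul4 (closure V) x.
  move=> dV DV; apply: (G00_sub_mul4 hG00) => //.
    by apply: cMtdef_closure; exact: Mtdef_definable.
  have [F FM FP] := type_quotients_generic dV DV.
  apply: (@cover_wide _ F) => //; first by apply: cMtdef_closure; exact: Mtdef_definable.
  by move=> g; have [f fF Vf] := FP g; exists f => //; exact: subset_closure.
pose S := prod_sort (prod_sort Gsort Gsort) (prod_sort Gsort Gsort).
pose W (V : dsup (type_quotients : set Gsort)) : set S := [set p |
  (closure (sval V) p.1.1 /\ closure (sval V) p.1.2) /\
  (closure (sval V) p.2.1 /\ closure (sval V) p.2.2)].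
have [|||||[[a b] [c e]] Wp xE] := @compactness S Gsort x _ W
  (fun p => p.1.1.1 * p.1.1.2 * p.1.2.1^-1 * p.1.2.2^-1 = p.2)%g.
- exact: dsup_inhabited.
- move=> [V [dV DV]].
  have tV : Mtdef (closure V : set Gsort) by apply: Mtdef_closure; exact: Mtdef_definable.
  have f1 := @definable_fun_fst _ _ (range j) (prod_sort Gsort Gsort) (prod_sort Gsort
    Gsort).
  have f2 := @definable_fun_snd _ _ (range j) (prod_sort Gsort Gsort) (prod_sort Gsort
    Gsort).
  have g1 := @definable_fun_fst _ _ (range j) Gsort Gsort.
  have g2 := @definable_fun_snd _ _ (range j) Gsort Gsort.
  apply: Mtdef_setI; apply: Mtdef_setI.
  + exact: (@Mtdef_pull S Gsort _ (closure V) (definable_fun_comp g1 f1)).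
  + exact: (@Mtdef_pull S Gsort _ (closure V) (definable_fun_comp g2 f1)).
  + exact: (@Mtdef_pull S Gsort _ (closure V) (definable_fun_comp g1 f2)).
  + exact: (@Mtdef_pull S Gsort _ (closure V) (definable_fun_comp g2 f2)).
- move=> V V'; have [V'' VV] := dsup_dir V V'; exists V'' => p [[H1 H2] [H3 H4]].
  have c1 := closureS (subset_trans VV (@subIsetl _ _ _)).
  have c2 := closureS (subset_trans VV (@subIsetr _ _ _)).
  by split; split; split; (exact: c1 || exact: c2).
- have f1 := @definable_fun_fst _ _ (range j) (prod_sort Gsort Gsort) (prod_sort Gsort
  Gsort).
  have f2 := @definable_fun_snd _ _ (range j) (prod_sort Gsort Gsort) (prod_sort Gsort
    Gsort).
  have g1 := @definable_fun_fst _ _ (range j) Gsort Gsort.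
  have g2 := @definable_fun_snd _ _ (range j) Gsort Gsort.
  have h1 := @definable_fun_fst _ _ (range j) S Gsort.
  apply: (definable_comp2 (f := fun p : prod_sort S Gsort =>
      (p.1.1.1 * p.1.1.2 * p.1.2.1^-1 * p.1.2.2^-1)%g : Gsort)
    (g := snd) (Q := fun p => p.1 = p.2)).
  + apply: Mfun_mulg; last first.
      by apply: Mfun_invg; exact: definable_fun_comp (definable_fun_comp g2 f2) h1.
    apply: Mfun_mulg; last first.
      by apply: Mfun_invg; exact: definable_fun_comp (definable_fun_comp g1 f2) h1.
    apply: Mfun_mulg; first exact: definable_fun_comp (definable_fun_comp g1 f1) h1.
    exact: definable_fun_comp (definable_fun_comp g2 f1) h1.
  + exact: definable_fun_snd.
  + exact: definable_eq.
- move=> [V [dV DV]].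
  have [_ [_ [a Va [b Vb <-]] [_ [c Vc <-] <-]] [_ [e Ve <-] <-]] := GV V dV DV.
  by exists ((a, b), (c, e)).
have cl z : (forall V : dsup (type_quotients : set Gsort), closure (sval V) z) ->
  closure type_quotients z.
  move=> H; apply: closure_Mtdef; first exact: Mtdef_type_quotients.
  by move=> V dV DV; exact: (H (dsup_mk dV DV)).
move: xE => /= <-; apply: mul_setI; first apply: mul_setI; first apply: mul_setI.
- by apply: cl => V; have [[]] := Wp V.
- by apply: cl => V; have [[]] := Wp V.
- by exists c => //; apply: cl => V; have [_ []] := Wp V.
- by exists e => //; apply: cl => V; have [_ []] := Wp V.
Qed.

Lemma G00_sub_closure (G00 : set G) : is_G00 K co (range j) G00 ->
  G00 `<=` closure (mul4 type_quotients).
Proof.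
move=> hG00 x /(G00_sub_mul4_closure hG00).
have cV : inv_set (closure type_quotients) `<=` closure (inv_set type_quotients) by
  exact: closure_inv.
move=> /(mul_setS (mul_setS (mul_setS (fun _ H => H) (fun _ H => H)) cV) cV).
move=> /(mul_setS (mul_setS (@closure_mul _ _ _) (fun _ H => H)) (fun _ H => H)).
by move=> /(mul_setS (@closure_mul _ _ _) (fun _ H => H)) /closure_mul.
Qed.

End Mean.

(** Makes G00 a competitor in the definition of G000, whence the inclusion of G000 in G00. *)
Lemma Aut_invariant_Mtdef (X : set Gsort) : Mtdef X -> Aut_invariant co (range j) X.
Proof.
move=> tX s sA sj.
have eqs (g h : G) : s \o co g = co h -> @same_type Gsort g h.
  move=> e Q [phi phiE] /phiE; rewrite (automorphism_sat _ _ sA) => H; apply/phiE.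
  congr (sat phi _) : H; apply/funext => -[v|a] /=.
    exact: (congr1 (fun f => f v) e).
  by apply: sj; exact: set_valP.
apply/seteqP; split.
  move=> _ [_ [g Xg <-] <-].
  have /group_domP[h hE] : sat (gdom Gm) (s \o co g).
    by rewrite -(automorphism_sat _ _ sA); apply/group_domP; exists g.
  exists h => //; apply: tX => Q dQ XQ.
  by apply: (eqs g h) => //; exact: XQ.
move=> _ [h Xh <-]; have [[t st ts] _ _] := sA.
have sth : s \o (t \o co h) = co h by apply/funext => v /=.
have /group_domP[g gE] : sat (gdom Gm) (t \o co h).
  by rewrite (automorphism_sat _ _ sA) sth; apply/group_domP; exists h.
exists (co g); last by rewrite gE.
exists g => //; apply: tX => Q dQ XQ.
have e : @same_type Gsort g h by apply: eqs; rewrite gE.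
by apply: (same_type_sym e) => //; exact: XQ.
Qed.

Lemma Mtdef_mul4 (X : set Gsort) : Mtdef X -> Mtdef (mul4 X : set Gsort).
Proof.
move=> tX; have tV := Mtdef_inv_set tX.
by do ![apply: Mtdef_mul_set => //].
Qed.

End MonsterGroup.

Theorem proposition3p52 (R : realType) (K : Type) (L : language)
    (M Ms : structure L) (j : M -> Ms)
    (d : nat) (Gm : group_formulas L d) (T : formula_family L d)
    (G : topGroupType) (co : G -> 'I_d -> Ms)
    (m : set G -> R) (G00 G000 : set G) :
  sufficiently_large K M ->
  monster K Ms ->
  elementary_embedding j ->
  vdefinable_group_topology Gm T Ms ->
  induced_topology Gm T co ->
  closed_projections K co ->
  invariant_mean K co m ->
  is_G00 K co (range j) G00 ->
  is_G000 K co (range j) G000 ->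
  [/\ closure G00 = closure G000,
      exists D : set G,
        [/\ tdef_over co (range j) D, D `<=` G000 & closure D = closure G00] &
      forall P : set G, closed P -> tdef_over co (range j) P -> (0 < m P)%R ->
        G00 `<=` mul_set (mul_set (mul_set P P) (inv_set P)) (inv_set P)].
Proof.
move=> Klarge [satMs homMs] jE _ topG projG mP hG00 hG000.
have tdfE := @MtdefP _ _ _ j (Gsort topG).
(* The chain D, G000, G00, cl(D) of inclusions proved below gives the first two conclusions. *)
pose D := mul4 (@type_quotients _ _ _ j _ _ _ _ _ topG).
have [[sub0 bd0 aut0] min0] := hG000.
have [[sub00 bd00 tdef00] _] := hG00.
have DG : D `<=` G000.
  have DM := type_quotients_sub Klarge satMs homMs jE sub0 bd0 aut0.
  have [_ GM GV] := sub0.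
  move=> _ [_ [_ [a /DM Ga [b /DM Gb <-]] [_ [c /DM Gc <-] <-]] [_ [e /DM Ge <-] <-]].
  by do 3?[apply: (GM) => //]; exact: (GV).
have GG : G000 `<=` G00.
  by apply: min0; split=> //; apply: (Aut_invariant_Mtdef (topG := topG)); apply/tdfE.
have GD : G00 `<=` closure D.
  exact: (G00_sub_closure Klarge satMs jE topG projG mP hG00).
have cD : closure G00 `<=` closure D.
  by rewrite [X in _ `<=` X]((closure_id _).1 (@closed_closure _ D)); exact: closureS.
have tD : tdef_over co (range j) D.
  by apply: (tdfE D).2; apply: (Mtdef_mul4 Klarge satMs jE);
    exact: (Mtdef_type_quotients Klarge satMs jE).
split.
- apply/seteqP; split; last exact: closureS.
  exact: subset_trans cD (closureS DG).
- exists D; split=> //; apply/seteqP; split=> //.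
  by apply: closureS; exact: subset_trans DG GG.
- move=> P cP tP P0; apply: (G00_sub_mul4 (topG := topG) Klarge satMs jE projG mP hG00 _ P0).
  exact: (conj cP ((tdfE P).1 tP)).
Qed.
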